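(* There is a constant $C\ge e$ such that the following holds for any $\tau\in(0,1)$. If an integer $k=k(n)\ge 2$ and the edge-probability $p=p(n)$ satisfy $$n^{-1+\tau}\le p\le (6C)^{-1}\cdot\big[k^2\log(1/p)\,np\big]^{-1/(2(k-1))}\cdot(1-p^k)^{n/(k-1)}$$ and $$\max\big\{np^2,\ p^{-(k-2)/2}\big\}\cdot(1-p^k)^{n(k-2)/(k-1)}\ \ge\ \mathbb{1}\{k\ge 3\}\,k^5\log(1/p),$$ then with high probability $$\chi_c(G_{n,p})\ \ge\ \frac{1}{C^2}\cdot\min\left\{\frac1p,\ \frac{p^{k/2}n}{\big[k!\,k\log(1/p)\big]^{1/(k-1)}}\right\}\cdot(1-p^k)^{n/(k-1)}.$$
   Context: $G_{n,p}$ denotes the binomial random graph on vertex set $[n]$ in which each pair of vertices is an edge independently with probability $p$. The clique chromatic number $\chi_c(G)$ is the smallest number of colors in a vertex coloring of $G$ such that no inclusion-maximal clique of $G$ is monochromatic (maximal cliques consisting of a single isolated vertex are ignored). $\mathbb{1}\{k\ge3\}$ is $1$ if $k\ge 3$ and $0$ otherwise. ''With high probability'' means with probability tending to $1$ as $n\to\infty$; $\log$ is the natural logarithm. *)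

(* Defs.v *)
From HB Require Import structures.
From mathcomp Require Import all_boot all_order all_algebra.
From mathcomp Require Import reals.

Set Implicit Arguments.
Unset Strict Implicit.
Unset Printing Implicit Defensive.

Import Order.TTheory GRing.Theory Num.Theory.

Local Open Scope ring_scope.

Record sgraph (T : finType) := SGraph {
  edges : {set {set T}};
  edgesP : edges \subset [set e : {set T} | #|e| == 2%N]
}.

HB.instance Definition _ (T : finType) := [isSub for @edges T].
HB.instance Definition _ (T : finType) := [Finite of sgraph T by <:].

Section CliqueColoring.
Variables (T : finType) (G : sgraph T).

Definition clique (K : {set T}) : bool :=
  [forall x in K, forall y in K, (x != y) ==> ([set x; y] \in edges G)].

Definition maximal_clique (K : {set T}) : bool := maxset clique K.

Definition monochromatic (q : nat) (f : {ffun T -> 'I_q}) (K : {set T}) : bool :=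
  [forall x in K, forall y in K, f x == f y].

(* A maximal clique with at most one vertex is an isolated vertex, or the empty
   clique of the graph without vertices; [1 < #|K|] discards exactly these. *)
Definition clique_coloring (q : nat) (f : {ffun T -> 'I_q}) : bool :=
  [forall K : {set T},
     maximal_clique K && (1 < #|K|)%N ==> ~~ monochromatic f K].

Definition clique_colorable (q : nat) : bool :=
  [exists f : {ffun T -> 'I_q}, clique_coloring f].

Lemma ex_clique_colorable : exists q, clique_colorable q.
Proof.
exists #|T|; apply/existsP; exists [ffun x => enum_rank x].
apply/forallP => K; apply/implyP => /andP[_ /card_gt1P[x [y [xK yK xy]]]].
apply/negP => /forall_inP/(_ x xK)/forall_inP/(_ y yK).
by rewrite !ffunE (inj_eq enum_rank_inj) (negPf xy).
Qed.

Definition clique_chromatic : nat := ex_minn ex_clique_colorable.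

End CliqueColoring.

Section BinomialRandomGraph.
Variables (R : realType) (n : nat) (p : R).

(* Product of the Bernoulli(p) laws of the indicators of the pairs, i.e. the
   pairs are edges independently with probability p. *)
Definition gnp_mass (G : sgraph 'I_n) : R :=
  \prod_(e : {set 'I_n} | #|e| == 2%N) (if e \in edges G then p else 1 - p).

Definition gnp_prob (A : pred (sgraph 'I_n)) : R :=
  \sum_(G : sgraph 'I_n | A G) gnp_mass G.

Lemma gnp_prob_predT : gnp_prob predT = 1.
Proof.
pose P : {set {set 'I_n}} := [set e : {set 'I_n} | #|e| == 2%N].
pose w (E : {set {set 'I_n}}) : R :=
  \prod_(e : {set 'I_n} | #|e| == 2%N) (if e \in E then p else 1 - p).
have -> : gnp_prob predT = \sum_(E : {set {set 'I_n}} | E \subset P) w E.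
  rewrite /gnp_prob (reindex_omap (@edges 'I_n) insub) /=.
    by apply: eq_bigl => G; rewrite edgesP valK eqxx.
  by move=> E sEP; rewrite insubT.
transitivity (\prod_(e : {set 'I_n})
    ((if #|e| == 2%N then p else 0) + (if #|e| == 2%N then 1 - p else 1))).
  transitivity (\sum_(E : {set {set 'I_n}}) \prod_(e : {set 'I_n})
      (if e \in E then (if #|e| == 2%N then p else 0)
       else (if #|e| == 2%N then 1 - p else 1))); last first.
    by rewrite bigA_distr; apply: eq_bigl.
  rewrite [RHS](bigID (fun E : {set {set 'I_n}} => E \subset P)) /=.
  rewrite [X in _ = _ + X]big1 ?addr0.
    apply: eq_big => // E /subsetP sEP.
    rewrite /w [RHS](bigID (fun e : {set 'I_n} => #|e| == 2%N)) /=.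
    rewrite [X in _ = _ * X]big1 ?mulr1.
      by apply: eq_bigr => e ->.
    move=> e en2; rewrite (negPf en2); case: ifP => // /sEP.
    by rewrite inE (negPf en2).
  move=> E /subsetPn[e eE]; rewrite inE => /negPf en2.
  by rewrite (bigD1 e) //= eE en2 mul0r.
by rewrite big1 // => e _; case: ifP => _; rewrite ?add0r // addrC subrK.
Qed.

End BinomialRandomGraph.

(* Main.v *)
(* A monochromatic set W contains a monochromatic maximal clique as soon as some
   k-clique K of W has no common neighbour outside W: every maximal clique
   containing K then lies in W.  With fewer colours than claimed, some colour
   class contains a set W whose size s is of order
     max(np, p^(-k/2) (k! k log(1/p))^(1/(k-1))) (1-p^k)^(-n/(k-1)),
   and since s >> np there are at most exp(s log(1/p)) such sets, so it suffices
   to bound the failure probability of a fixed W by exp(-3 s log(1/p)).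

   The edges between W and its complement are revealed first.  They determine
   the k-subsets of W that are covered by no outside vertex, and about a fraction
   (1-p^k)^n of all k-subsets is uncovered: this is an exponential-moment bound,
   one outside vertex at a time, the number of k-sets covered by a random
   neighbourhood being controlled by revealing this neighbourhood bit by bit.
   Vertices with unusually many neighbours in W spoil the bounded differences;
   they are integrated out first, and their contribution is small because no
   degree exceeds 8np, which is much smaller than s.  The edges inside W are
   independent of all this, and Janson's inequality applied to the uncovered
   k-subsets alone produces a k-clique among them. *)
Require Import Defs.
From mathcomp Require Import all_boot all_order all_algebra.
From mathcomp Require Import all_classical all_reals all_analysis.
From mathcomp Require Import ring lra zify.

Set Implicit Arguments.
Unset Strict Implicit.
Unset Printing Implicit Defensive.

Import mathcomp.boot.fintype mathcomp.boot.finset.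
Import Order.TTheory GRing.Theory Num.Theory.
Import numFieldNormedType.Exports.

Local Open Scope ring_scope.

(** * Bernoulli product measures *)

Section BernoulliProduct.
Variables (R : realType) (I : finType).
Implicit Types (P : I -> R) (f g : {set I} -> R) (E S : {set I}).

Definition bern P E : R := \prod_i (if i \in E then P i else 1 - P i).

Definition Ex P f : R := \sum_E bern P E * f E.

Lemma eq_Ex P f g : f =1 g -> Ex P f = Ex P g.
Proof. by move=> fg; apply: eq_bigr => E _; rewrite fg. Qed.

Lemma ExD P f g : Ex P (fun E => f E + g E) = Ex P f + Ex P g.
Proof. by rewrite -big_split; apply: eq_bigr => E _; rewrite mulrDr. Qed.

Lemma ExZ P c f : Ex P (fun E => c * f E) = c * Ex P f.
Proof. by rewrite mulr_sumr; apply: eq_bigr => E _; rewrite mulrCA. Qed.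

Lemma ExB P f g : Ex P (fun E => f E - g E) = Ex P f - Ex P g.
Proof.
by rewrite -[- Ex P g]mulN1r -ExZ -ExD; apply: eq_Ex => E; rewrite mulN1r.
Qed.

Lemma Ex_sum P (J : Type) (r : seq J) (Q : pred J) (F : J -> {set I} -> R) :
  Ex P (fun E => \sum_(j <- r | Q j) F j E) = \sum_(j <- r | Q j) Ex P (F j).
Proof.
by rewrite exchange_big; apply: eq_bigr => E _; rewrite mulr_sumr.
Qed.

Lemma ExC P P' (f : {set I} -> {set I} -> R) :
  Ex P (fun E => Ex P' (f E)) = Ex P' (fun E' => Ex P (f^~ E')).
Proof.
rewrite /Ex; under eq_bigr do rewrite mulr_sumr.
rewrite exchange_big; apply: eq_bigr => E _.
by rewrite mulr_sumr; apply: eq_bigr => E' _; rewrite mulrCA.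
Qed.

Definition Ex_bit P (i : I) f E := P i * f (i |: E) + (1 - P i) * f (E :\ i).

Lemma Ex_bitE P i f : Ex P (Ex_bit P i f) = Ex P f.
Proof.
pose h E := \prod_(j | j != i) (if j \in E then P j else 1 - P j).
have hU E : h (i |: E) = h E.
  by apply: eq_bigr => j ji; rewrite !inE (negPf ji).
have hD E : h (E :\ i) = h E by apply: eq_bigr => j ji; rewrite !inE ji.
have bE E : bern P E = (if i \in E then P i else 1 - P i) * h E.
  by rewrite /bern (bigD1 i).
have split_sum (F : {set I} -> R) :
    \sum_E F E = \sum_(E : {set I} | i \notin E) (F (i |: E) + F E).
  rewrite (bigID (fun E => i \in E)) big_split /=; congr (_ + _).
  rewrite (reindex_onto (fun E => i |: E) (fun E => E :\ i)) /=; last first.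
    by move=> E iE; exact: setD1K.
  apply: eq_bigl => E; rewrite !inE eqxx /=.
  apply/eqP/idP => [<-|/setU1K //]; by rewrite !inE eqxx.
rewrite /Ex !split_sum; apply: eq_bigr => E iE.
rewrite !bE hU !inE eqxx (negPf iE) /Ex_bit.
have -> : i |: (i |: E) = i |: E by rewrite setUA setUid.
have -> : (i |: E) :\ i = E by rewrite setU1K.
have -> : E :\ i = E.
  by apply/setP=> j; rewrite !inE; case: eqP => // ->; rewrite (negPf iE).
rewrite /=; ring.
Qed.

Lemma Ex_cst P c : Ex P (fun=> c) = c.
Proof.
rewrite /Ex -mulr_suml (_ : \sum_E bern P E = 1) ?mul1r //.
transitivity (\prod_i (P i + (1 - P i))); first by rewrite bigA_distr.
by apply: big1 => i _; rewrite addrC subrK.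
Qed.

Section Monotone.
Variables (P : I -> R) (P01 : forall i, 0 <= P i <= 1).

Lemma bern_ge0 E : 0 <= bern P E.
Proof.
apply: prodr_ge0 => i _; have /andP[p0 p1] := P01 i.
by case: ifP; rewrite ?subr_ge0.
Qed.

Lemma le_Ex f g : (forall E, f E <= g E) -> Ex P f <= Ex P g.
Proof. by move=> fg; apply: ler_sum => E _; rewrite ler_wpM2l ?bern_ge0. Qed.

Lemma Ex_ge0 f : (forall E, 0 <= f E) -> 0 <= Ex P f.
Proof. by move=> f0; apply: sumr_ge0 => E _; rewrite mulr_ge0 ?bern_ge0. Qed.

Lemma Ex_le_cst f c : (forall E, f E <= c) -> Ex P f <= c.
Proof. by move=> fc; rewrite -[leRHS](Ex_cst P); apply: le_Ex. Qed.

End Monotone.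

Lemma Ex_foldr P (l : seq I) f : Ex P (foldr (Ex_bit P) f l) = Ex P f.
Proof. by elim: l => //= i l <-; rewrite Ex_bitE. Qed.

Lemma Ex_resample P S f :
  Ex P f = Ex P (fun E1 => Ex P (fun E2 => f ((E1 :&: S) :|: (E2 :\: S)))).
Proof.
pose F S := Ex P (fun E1 => Ex P (fun E2 => f ((E1 :&: S) :|: (E2 :\: S)))).
rewrite -/(F S) -(set_enum S).
elim: (enum S) => [|i l IH].
  rewrite /F -[LHS](Ex_cst P); apply: eq_Ex => E1; apply: eq_Ex => E2.
  congr f; apply/setP => j; rewrite !inE; by case: (j \in E1).
rewrite IH /F [LHS]ExC [RHS]ExC.
pose G E2 E1 :=
  f (E1 :&: [set x in l] :|: E2 :\: [set x in l]).
transitivity (Ex P (fun E2 => Ex P (fun E1 =>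
    P i * G (i |: E2) E1 + (1 - P i) * G (E2 :\ i) E1))).
  rewrite -(Ex_bitE P i); apply: eq_Ex => E2.
  by rewrite /Ex_bit ExD !ExZ.
apply: eq_Ex => E2; rewrite -[RHS](Ex_bitE P i).
have [il|il] := boolP (i \in l).
  rewrite /Ex_bit !ExD !ExZ.
  have eG E E' : (forall j, j != i -> (j \in E) = (j \in E')) -> G E =1 G E'.
    move=> EE' E1; congr f; apply/setP => j; rewrite !inE.
    have [->|ji] := eqVneq j i; first by rewrite il.
    by rewrite EE'.
  rewrite (eq_Ex _ (eG (i |: E2) E2 _)); last by move=> j ji; rewrite !inE (negPf ji).
  rewrite (eq_Ex _ (eG (E2 :\ i) E2 _)); last by move=> j ji; rewrite !inE ji.
  rewrite -mulrDl [_ + (1 - _)]addrC subrK mul1r -(Ex_bitE P i) ExD !ExZ.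
  have -> : [set x in i :: l] = [set x in l].
    by apply/setP => j; rewrite !inE; case: eqP => // ->.
  by [].
apply: eq_Ex => E1; rewrite /Ex_bit; congr (_ * _ + _ * _); congr f.
  apply/setP => j; rewrite !inE.
  by have [->|ji] := eqVneq j i; rewrite ?(negPf il) ?andbF.
apply/setP => j; rewrite !inE.
by have [->|ji] := eqVneq j i; rewrite ?(negPf il) ?andbF.
Qed.

End BernoulliProduct.

Section Correlation.
Variables (R : realType) (I : finType).
Variables (P : I -> R) (P01 : forall i, 0 <= P i <= 1).
Implicit Types (f g : {set I} -> R) (E S : {set I}).

Lemma Ex_subset S : Ex P (fun E => (S \subset E)%:R) = \prod_(i in S) P i.
Proof.
transitivity (\sum_(E : {set I}) \prod_i (if i \in E then P i
                              else if i \in S then 0 else 1 - P i)).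
  rewrite /Ex; apply: eq_bigr => /= E _; have [SE|/subsetPn[i iS iE]] := boolP (S \subset E).
    rewrite mulr1; apply: eq_bigr => i _; case: ifP => // iE.
    by case: ifP => // /(subsetP SE); rewrite iE.
  by rewrite mulr0 [RHS](bigD1 i) //= (negPf iE) iS mul0r.
rewrite -bigA_distr [RHS]big_mkcond; apply: eq_bigr => i _.
by case: ifP => _ /=; rewrite ?addr0 // addrC subrK.
Qed.

Lemma Ex_indep S f g : (forall E, f E = f (E :&: S)) ->
  (forall E, g E = g (E :\: S)) ->
  Ex P (fun E => f E * g E) = Ex P f * Ex P g.
Proof.
move=> fS gS; rewrite (Ex_resample P S) mulrC -ExZ.
apply: eq_Ex => E1; rewrite mulrC -ExZ; apply: eq_Ex => E2.
rewrite fS gS [f E1]fS [g E2]gS; congr (f _ * g _); apply/setP => i; rewrite !inE.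
  by case: (i \in S); rewrite ?andbF ?orbF ?andbT.
by case: (i \in S); rewrite ?andbF ?orbF ?andbT.
Qed.

Definition increasing f := forall E E', E \subset E' -> f E <= f E'.
Definition decreasing f := forall E E', E \subset E' -> f E' <= f E.

Lemma le_Ex_bit i f g : (forall E, f E <= g E) ->
  forall E, Ex_bit P i f E <= Ex_bit P i g E.
Proof.
move=> fg E; have /andP[p0 p1] := P01 i.
by rewrite lerD // ler_wpM2l // subr_ge0.
Qed.

Lemma Ex_bit_incr i f : increasing f -> increasing (Ex_bit P i f).
Proof.
move=> fi E E' EE'; have /andP[p0 p1] := P01 i.
by rewrite lerD // ler_wpM2l ?subr_ge0 // fi ?setUS ?setSD.
Qed.

Lemma Ex_bit_decr i f : decreasing f -> decreasing (Ex_bit P i f).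
Proof.
move=> fi E E' EE'; have /andP[p0 p1] := P01 i.
by rewrite lerD // ler_wpM2l ?subr_ge0 // fi ?setUS ?setSD.
Qed.

Lemma foldr_Ex_bit_decr l f : decreasing f -> decreasing (foldr (Ex_bit P) f l).
Proof. by move=> fd; elim: l => //= i l; apply: Ex_bit_decr. Qed.

Lemma foldr_Ex_bit_incr l f : increasing f -> increasing (foldr (Ex_bit P) f l).
Proof. by move=> fd; elim: l => //= i l; apply: Ex_bit_incr. Qed.

Lemma foldr_Ex_bit_off l f E E' :
  (forall j, j \notin l -> (j \in E) = (j \in E')) ->
  foldr (Ex_bit P) f l E = foldr (Ex_bit P) f l E'.
Proof.
elim: l E E' => [|i l IH] E E' EE' /=.
  by congr f; apply/setP => j; apply: EE'.
rewrite /Ex_bit; congr (_ * _ + _ * _); apply: IH => j jl; rewrite !inE;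
  by have [//|ji] := eqVneq j i; rewrite EE' // inE negb_or ji.
Qed.

Lemma Ex_foldr_enum f E : foldr (Ex_bit P) f (enum I) E = Ex P f.
Proof.
rewrite -(Ex_foldr P (enum I)) -[LHS](Ex_cst P); apply: eq_Ex => E'.
by apply: foldr_Ex_bit_off => j; rewrite mem_enum.
Qed.

Lemma harris f g : increasing f -> decreasing g ->
  Ex P (fun E => f E * g E) <= Ex P f * Ex P g.
Proof.
move=> fi gd; rewrite -(Ex_foldr_enum _ set0) -(Ex_foldr_enum f set0).
rewrite -(Ex_foldr_enum g set0).
elim: (enum I) (set0 : {set I}) => //= i l IH E.
apply: le_trans (le_Ex_bit i IH E) _.
have := foldr_Ex_bit_incr l fi; have := foldr_Ex_bit_decr l gd.
move: (foldr _ f l) (foldr _ g l) => {fi gd IH} F G Gd Fi.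
have EiE : E :\ i \subset i |: E.
  by apply/subsetP => j; rewrite !inE => /andP[_ ->]; rewrite orbT.
have := Gd _ _ EiE; have := Fi _ _ EiE; have /andP[] := P01 i; rewrite /Ex_bit /=.
move: (P i) (F _) (F _) (G _) (G _) => p a b c d p0 p1 ba cd.
rewrite -subr_ge0.
have -> : (p * a + (1 - p) * b) * (p * d + (1 - p) * c)
    - (p * (a * d) + (1 - p) * (b * c)) = p * (1 - p) * ((a - b) * (c - d)).
  by ring.
by rewrite !mulr_ge0 // subr_ge0.
Qed.

Section Janson.
Variables (J : eqType) (F : J -> {set I}) (q : R).
Hypothesis q01 : 0 <= q <= 1.

Let X (j : J) E : R := (F j \subset E)%:R.

Let fac01 j E : 0 <= 1 - q * X j E <= 1.
Proof. by have /andP[q0 q1] := q01; rewrite /X; case: (_ \subset _) => /=; lra. Qed.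

Let prod01 (s : seq J) (Q : pred J) E : 0 <= \prod_(j <- s | Q j) (1 - q * X j E) <= 1.
Proof.
rewrite prodr_ge0 => [/=|j _]; last by have /andP[] := fac01 j E.
by apply: prodr_ile1 => j _; apply: fac01.
Qed.

Let prod_decr (s : seq J) (Q : pred J) :
  decreasing (fun E => \prod_(j <- s | Q j) (1 - q * X j E)).
Proof.
move=> E E' EE'; apply: ler_prod => j _; have /andP[-> _] /= := fac01 j E'.
rewrite lerD2l lerN2 ler_wpM2l ?(andP q01).1 //.
by rewrite ler_nat; case: (boolP (F j \subset E)) => // /subset_trans/(_ EE') ->.
Qed.

Let prod_ge (s : seq J) (Q : pred J) E :
  1 - q * \sum_(j <- s | Q j) X j E <= \prod_(j <- s | Q j) (1 - q * X j E).
Proof.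
elim: s => [|j s IH]; first by rewrite !big_nil mulr0 subr0.
rewrite !big_cons; case: (Q j) => //.
have X0 : 0 <= \sum_(j <- s | Q j) X j E by apply: sumr_ge0 => ? _; apply: ler0n.
have /andP[f0 f1] := fac01 j E; have x0 : 0 <= X j E by apply: ler0n.
have /andP[q0 q1] := q01.
apply: le_trans (ler_wpM2l f0 IH).
by have := mulr_ge0 (mulr_ge0 q0 q0) (mulr_ge0 x0 X0); lra.
Qed.

(* The standard proof of Janson's inequality run on the weights [1 - q X_j];
   the parameter [q] replaces the usual passage to a random subfamily. *)
Lemma janson (s : seq J) : uniq s ->
  Ex P (fun E => \prod_(j <- s) (1 - q * X j E)) <=
  expR (- q * (\sum_(j <- s) \prod_(e in F j) P e)
        + q ^+ 2 * \sum_(i <- s) \sum_(j <- s | (j != i) && ~~ [disjoint F i & F j])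
            \prod_(e in F i :|: F j) P e).
Proof.
elim: s => [|i s IH] /=.
  by rewrite !big_nil !mulr0 addr0 expR0 (eq_Ex _ (g := fun=> 1)) ?Ex_cst // => E; rewrite big_nil.
move=> /andP[is_ us]; have {}IH := IH us; have /andP[q0 q1] := q01.
pose pr S := \prod_(e in S) P e.
have pr0 S : 0 <= pr S by apply: prodr_ge0 => e _; have /andP[] := P01 e.
pose d := \sum_(j <- s | ~~ [disjoint F i & F j]) pr (F i :|: F j).
pose f E := \prod_(j <- s) (1 - q * X j E).
pose g E := \prod_(j <- s | [disjoint F i & F j]) (1 - q * X j E).
have f0 : 0 <= Ex P f by apply: Ex_ge0 => // E; have /andP[] := prod01 s xpredT E.
have fg : Ex P f <= Ex P g.
  apply: le_Ex => // E; rewrite /f (bigID (fun j => [disjoint F i & F j])) /=.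
  have /andP[g0 _] := prod01 s (fun j => [disjoint F i & F j]) E.
  have /andP[_ h1] := prod01 s (fun j => ~~ [disjoint F i & F j]) E.
  by apply: ler_piMr.
have step : Ex P f * (pr (F i) - q * d) <= Ex P (fun E => X i E * f E).
  have [neg|pos] := leP (pr (F i) - q * d) 0.
    apply: (@le_trans _ _ 0); first by rewrite mulr_ge0_le0.
    apply: Ex_ge0 => // E; rewrite mulr_ge0 ?ler0n //.
    by have /andP[] := prod01 s xpredT E.
  apply: (@le_trans _ _ (Ex P g * (pr (F i) - q * d))); first by rewrite ler_wpM2r // ltW.
  apply: (@le_trans _ _ (Ex P (fun E => X i E * g E - q *
      \sum_(j <- s | ~~ [disjoint F i & F j]) (X i E * X j E * g E)))).
    rewrite ExB ExZ Ex_sum mulrBr lerB //.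
      rewrite (Ex_indep (S := F i) (f := X i)) ?Ex_subset 1?mulrC // => E.
        by rewrite /X subsetI subxx andbT.
      apply: eq_bigr => j dij; rewrite /X; congr (1 - q * _); congr (_%:R).
      congr nat_of_bool.
      by rewrite subsetD disjoint_sym dij andbT.
    rewrite mulrCA ler_wpM2l // mulr_sumr; apply: ler_sum => j _.
    rewrite mulrC /pr -Ex_subset.
    under eq_Ex => E do rewrite /X -natrM mulnb -subUset.
    apply: harris; last exact: prod_decr.
    move=> E E' EE'; rewrite ler_nat.
    by case: (boolP (_ \subset E)) => // /subset_trans/(_ EE') ->.
  apply: le_Ex => // E; rewrite /f [X in _ <= _ * X](bigID (fun j => [disjoint F i & F j])) /= -/(g E).
  rewrite -mulr_suml -mulr_sumr.
  have /andP[g0 _] := prod01 s (fun j => [disjoint F i & F j]) E.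
  have := prod_ge s (fun j => ~~ [disjoint F i & F j]) E.
  move=> /(ler_wpM2l (mulr_ge0 (ler0n R (F i \subset E)) g0)).
  rewrite -/(g E) -/(X i E) => H; rewrite [leRHS]mulrA; apply: le_trans H.
  by rewrite le_eqVlt; apply/orP; left; apply/eqP; ring.
have -> : Ex P (fun E => \prod_(j <- i :: s) (1 - q * X j E)) =
          Ex P f - q * Ex P (fun E => X i E * f E).
  by rewrite -ExZ -ExB; apply: eq_Ex => E; rewrite big_cons -/(f E); ring.
apply: (@le_trans _ _ (Ex P f * (1 + - q * (pr (F i) - q * d)))); first by nra.
apply: le_trans (ler_wpM2l f0 (expR_ge1Dx _)) _.
apply: le_trans (ler_wpM2r (expR_ge0 _) IH) _.
rewrite -expRD ler_expR !big_cons -/(pr _) eqxx /=.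
have e1 : \sum_(j <- s | (j != i) && ~~ [disjoint F i & F j])
            \prod_(e in F i :|: F j) P e = d.
  rewrite big_seq_cond [in RHS]/d [RHS]big_seq_cond; apply: eq_bigl => j.
  by case: (boolP (j \in s)) => //= js; case: eqP => // ji; rewrite -ji js in is_.
rewrite e1.
have e2 : \sum_(j <- s) \sum_(k <- s | (k != j) && ~~ [disjoint F j & F k]) pr (F j :|: F k)
  <= \sum_(j <- s) \sum_(k <- i :: s | (k != j) && ~~ [disjoint F j & F k]) pr (F j :|: F k).
  apply: ler_sum => j _; rewrite big_cons; case: ifP => // _.
  by rewrite lerDr.
have q20 : 0 <= q ^+ 2 by apply: sqr_ge0.
have := ler_wpM2l q20 e2; rewrite /pr; nra.
Qed.

End Janson.

Lemma Ex_card_ge (d : nat) (A : {set I}) (x : R) : (forall i, P i <= x) ->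
  Ex P (fun E => (d <= #|E :&: A|)%N%:R) <= 'C(#|A|, d)%:R * x ^+ d.
Proof.
move=> Px; apply: (@le_trans _ _ (Ex P (fun E =>
  \sum_(S : {set I} | (S \subset A) && (#|S| == d)) (S \subset E)%:R))).
  apply: le_Ex => // E; case: leqP => [dE|_]; last by apply: sumr_ge0 => S _; apply: ler0n.
  have [S SA cS] : exists2 S : {set I}, S \subset E :&: A & #|S| == d.
    have : (0 < #|[set S : {set I} | S \subset E :&: A & #|S| == d]|)%N.
      by rewrite cards_draws bin_gt0.
    by rewrite card_gt0 => /set0Pn[S]; rewrite inE => /andP[]; exists S.
  move: SA; rewrite subsetI => /andP[SE SA].
  by rewrite (bigD1 S) ?SA // SE lerDl; apply: sumr_ge0 => ? _; apply: ler0n.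
rewrite Ex_sum -cards_draws mulrC mulr_natr -sumr_const.
rewrite [leRHS](eq_bigl (fun S : {set I} => (S \subset A) && (#|S| == d))); last first.
  by move=> S; rewrite inE.
apply: ler_sum => S /andP[_ /eqP <-].
rewrite Ex_subset -prodr_const; apply: ler_prod => i _.
by have /andP[-> _] := P01 i; rewrite Px.
Qed.

End Correlation.

Lemma Ex_preim (R : realType) (I J : finType) (P : I -> R) (P' : J -> R)
    (h : J -> I) (A : {set J}) (f : {set J} -> R) :
  {in A &, injective h} -> {in A, forall j, P (h j) = P' j} ->
  Ex P (fun E => f [set j in A | h j \in E]) = Ex P' (fun N => f (N :&: A)).
Proof.
rewrite -(set_enum A); move: (enum_uniq A); elim: (enum A) f => [|j l IH] f.
  move=> _ _ _; transitivity (f set0); [rewrite -[RHS](Ex_cst P)|rewrite -[LHS](Ex_cst P')];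
    by apply: eq_Ex => E; congr f; apply/setP => j; rewrite !inE ?andbF.
move=> /andP[jl ul] hinj hP.
have jA : j \in [set x in j :: l] by rewrite !inE eqxx.
have lA x : x \in l -> x \in [set x in j :: l] by rewrite !inE => ->; rewrite orbT.
have hinj' : {in [set x in l] &, injective h}.
  by move=> x y; rewrite !inE => xl yl; apply: hinj; apply: lA.
have hP' : {in [set x in l], forall j, P (h j) = P' j}.
  by move=> x; rewrite !inE => xl; apply/hP/lA.
rewrite -(Ex_bitE P (h j)) -(Ex_bitE P' j) !ExD !ExZ hP //.
have hj x : x \in l -> x != j -> (h x == h j) = false.
  by move=> xl xj; apply/negP => /eqP/(hinj _ _ (lA _ xl) jA)/eqP; rewrite (negPf xj).
have eI b E : [set x in [set x in j :: l] | h x \in (if b then h j |: E else E :\ h j)] =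
   if b then j |: [set x in [set x in l] | h x \in E] else [set x in [set x in l] | h x \in E].
  apply/setP => x; case: b; rewrite !inE; have [->|xj] := eqVneq x j;
    rewrite ?eqxx ?(negPf jl) //=; case: (boolP (x \in l)) => //= xl.
    by rewrite hj.
  by rewrite hj.
have eJ b (N : {set J}) : (if b then j |: N else N :\ j) :&: [set x in j :: l] =
   if b then j |: (N :&: [set x in l]) else N :&: [set x in l].
  apply/setP => x; case: b; rewrite !inE; have [->|xj] := eqVneq x j;
    by rewrite ?eqxx ?(negPf jl) ?andbF.
congr (_ * _ + _ * _).
  transitivity (Ex P (fun E => f (j |: [set x in [set x in l] | h x \in E]))).
    by apply: eq_Ex => E; rewrite -(eI true E).
  transitivity (Ex P' (fun N => f (j |: (N :&: [set x in l])))); last first.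
    by apply: eq_Ex => N; rewrite -(eJ true N).
  exact: (IH (fun N => f (j |: N))).
transitivity (Ex P (fun E => f [set x in [set x in l] | h x \in E])).
  by apply: eq_Ex => E; rewrite -(eI false E).
transitivity (Ex P' (fun N => f (N :&: [set x in l]))); last first.
  by apply: eq_Ex => N; rewrite -(eJ false N).
exact: IH.
Qed.

(** * Exponential moments for random subsets *)

Section RandomSubset.
Variables (R : realType) (T : finType).
Implicit Types (A : {set {set T}}) (U W N K : {set T}) (y : T -> R).

Definition sum_prod A y : R := \sum_(K in A) \prod_(w in K) y w.

Definition uniform k W A := [forall K in A, (K \subset W) && (#|K| == k)].

Lemma uniformP k W A K : uniform k W A -> K \in A -> K \subset W /\ #|K| = k.
Proof. by move=> /forall_inP uA /uA /andP[? /eqP]. Qed.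

Definition ksubsets k W := [set K : {set T} | K \subset W & #|K| == k].

Lemma sum_link_le j W A w y : uniform j.+1 W A -> (forall v, 0 <= y v) ->
  \sum_(K in A | w \in K) \prod_(v in K :\ w) y v <= sum_prod (ksubsets j W) y.
Proof.
move=> uA y0.
rewrite (reindex_onto (fun K => w |: K) (fun K => K :\ w)) /=; last first.
  by move=> K /andP[_ wK]; rewrite setD1K.
rewrite (eq_bigr (fun K => \prod_(v in K) y v)); last by move=> K /andP[_ /eqP ->].
rewrite /sum_prod.
rewrite [leRHS](bigID (fun K => ((w |: K \in A) && (w \in w |: K)) &&
                                ((w |: K) :\ w == K))) /=.
rewrite -[leLHS]addr0 lerD //; last by apply: sumr_ge0 => K _; apply: prodr_ge0.
rewrite le_eqVlt; apply/orP; left; apply/eqP/eq_bigl => K.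
case: (boolP (_ && (_ == K))) => [/andP[/andP[KA _] /eqP eK]|]; last by rewrite andbF.
have [KW cK] := uniformP uA KA.
have wK : w \notin K by rewrite -eK !inE eqxx.
move: cK; rewrite cardsU1 wK add1n => -[cK].
by rewrite inE cK eqxx andbT andbT (subset_trans _ KW) // subsetUr.
Qed.

Lemma esym_le j W y : (forall v, 0 <= y v) ->
  j`!%:R * sum_prod (ksubsets j W) y <= (\sum_(w in W) y w) ^+ j.
Proof.
move=> y0; elim: j => [|j IH].
  rewrite mul1r expr0 /sum_prod (big_pred1 set0) ?big_set0 // => K.
  by rewrite inE cards_eq0 /=; case: eqP => [->|]; rewrite ?sub0set ?andbF.
have uK : uniform j.+1 W (ksubsets j.+1 W) by apply/forall_inP => K; rewrite inE.
have e : j.+1%:R * sum_prod (ksubsets j.+1 W) y =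
    \sum_(w in W) y w * \sum_(K in ksubsets j.+1 W | w \in K) \prod_(v in K :\ w) y v.
  transitivity (\sum_(K in ksubsets j.+1 W) \sum_(w in K) \prod_(v in K) y v).
    rewrite mulr_sumr; apply: eq_bigr => K; rewrite inE => /andP[_ /eqP <-].
    by rewrite sumr_const mulr_natl.
  rewrite (exchange_big_dep (mem W)) /=; last first.
    by move=> K w; rewrite inE => /andP[/subsetP KW _]; apply: KW.
  apply: eq_bigr => w wW; rewrite mulr_sumr; apply: eq_bigr => K /andP[_ wK].
  by rewrite (big_setD1 w).
rewrite factS natrM mulrAC e mulrC mulr_sumr.
rewrite exprSr mulr_sumr; apply: ler_sum => w wW.
rewrite mulrCA mulrC ler_wpM2r //.
by apply: le_trans IH; rewrite ler_wpM2l ?ler0n // sum_link_le.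
Qed.

Lemma expR_le_quad (t : R) : 0 <= t <= 1 / 2 -> expR t <= 1 + t + 2 * t ^+ 2.
Proof.
move=> /andP[t0 t1].
have h := expR_ge1Dx (- t); rewrite expRN in h.
have e0 := expR_gt0 t.
have : (1 - t) * expR t <= 1.
  have := ler_wpM2r (ltW e0) h; by rewrite mulVf ?lt0r_neq0.
move: (expR t) e0 => e e0 {}h; nra.
Qed.

Lemma bernoulli_mgf (p t : R) : 0 <= p <= 1 -> 0 <= t <= 1 / 2 ->
  p * expR ((1 - p) * t) + (1 - p) * expR (- p * t) <= expR (2 * p * t ^+ 2).
Proof.
move=> /andP[p0 p1] t01; have e := expR_le_quad t01.
rewrite (_ : (1 - p) * t = t + - p * t); last by ring.
rewrite expRD mulrA -mulrDl.
have h : p * expR t + (1 - p) <= expR (p * t + 2 * p * t ^+ 2).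
  apply: le_trans (expR_ge1Dx _); nra.
apply: le_trans (ler_wpM2r (expR_ge0 _) h) _.
by rewrite -expRD ler_expR; lra.
Qed.

Section TruncatedMgf.
Variables (k : nat) (W : {set T}) (A : {set {set T}}) (p th D : R).
Hypotheses (uA : uniform k.+1 W A) (p01 : 0 <= p <= 1) (th0 : 0 <= th).

Let c := (D + p * #|W|%:R) ^+ k / k`!%:R.
Hypothesis thc : th * c <= 1 / 2.

Let cnt N := #|[set K in A | K \subset N]|.
(* [sum_prod A (y l N)] is the conditional expectation of [cnt] when the bits
   outside [l] are those of [N]. *)
Let y (l : seq T) N w : R := if w \in l then p else (w \in N)%:R.
Let f N : R := (#|N :&: W|%:R <= D)%R%:R * expR (th * (cnt N)%:R).

Let y0 l N w : 0 <= y l N w.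
Proof. by rewrite /y; case: ifP => _; rewrite ?ler0n // (andP p01).1. Qed.

Let sum_y l N : \sum_(w in W) y l N w <= #|(N :&: W) :\: [set w in l]|%:R + p * #|W|%:R.
Proof.
rewrite (bigID (fun w => w \in l)) /= addrC lerD //.
  rewrite -sumr_const (bigID (fun w => w \in N)) /= [X in _ + X]big1 ?addr0.
    rewrite le_eqVlt; apply/orP; left; apply/eqP.
    apply: eq_big => [w|w]; first by rewrite !inE [LHS]andbC andbA [LHS]andbC andbCA.
    by move=> /andP[/andP[_ /negPf wl] wN]; rewrite /y wl wN.
  by move=> w /andP[/andP[_ /negPf wl] /negPf wN]; rewrite /y wl wN.
rewrite (eq_bigr (fun=> p)) => [|w /andP[_ wl]]; last by rewrite /y wl.
rewrite sumr_const mulr_natr -[leLHS]mulr_natr -[leRHS]mulr_natr.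
rewrite ler_wpM2l ?(andP p01).1 // ler_nat.
by apply: subset_leq_card; apply/subsetP => w /andP[].
Qed.

Let sum_prod_shift w (z z' : T -> R) : (forall v, v != w -> z v = z' v) ->
  sum_prod A z' = sum_prod A z +
    (z' w - z w) * \sum_(K in A | w \in K) \prod_(v in K :\ w) z v.
Proof.
move=> zz'; have big_off (x : T -> R) : (forall v, v != w -> x v = z v) ->
    sum_prod A x = x w * \sum_(K in A | w \in K) \prod_(v in K :\ w) z v
      + \sum_(K in A | w \notin K) \prod_(v in K) z v.
  move=> xz; rewrite /sum_prod (bigID (fun K => w \in K)) /=; congr (_ + _).
    rewrite mulr_sumr; apply: eq_bigr => K /andP[_ wK].
    rewrite (big_setD1 w) //=; congr (_ * _); apply: eq_bigr => v.
    by rewrite !inE => /andP[/xz].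
  apply: eq_bigr => K /andP[_ wK]; apply: eq_bigr => v vK; apply: xz.
  by apply: contraNneq wK => <-.
rewrite (big_off z) // (big_off z') => [|v vw]; last by rewrite zz'.
ring.
Qed.

Let foldr_mgf l N : uniq l -> {subset l <= W} ->
  foldr (Ex_bit (fun=> p)) f l N <=
  (#|(N :&: W) :\: [set w in l]|%:R <= D)%R%:R *
    expR (th * sum_prod A (y l N) + (size l)%:R * (2 * p * (th * c) ^+ 2)).
Proof.
have /andP[p0 p1] := p01; have q0 : 0 <= 1 - p by rewrite subr_ge0.
elim: l N => [|w l IH] N.
  move=> _ _; rewrite /= mul0r addr0 /f (_ : _ :\: _ = N :&: W); last first.
    by apply/setP => v; rewrite !inE.
  rewrite ler_wpM2l ?ler0n // ler_expR ler_wpM2l //.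
  rewrite /cnt -sum1_card natr_sum /sum_prod big_mkcond [leRHS]big_mkcond /=.
  apply: ler_sum => K _; rewrite inE; case: (K \in A) => //=.
  case: ifP => [/subsetP KN|_]; last by apply: prodr_ge0 => v _.
  by rewrite big1 // => v /KN vN; rewrite /y /= vN.
move=> /= /andP[wl ul] lW.
have wW : w \in W by apply: lW; rewrite inE eqxx.
have {}lW : {subset l <= W} by move=> v vl; apply: lW; rewrite inE vl orbT.
set z := y (w :: l) N.
pose Z := \sum_(K in A | w \in K) \prod_(v in K :\ w) z v.
have z0 v : 0 <= z v by apply: y0.
have e1 : sum_prod A (y l (w |: N)) = sum_prod A z + (1 - p) * Z.
  rewrite (sum_prod_shift (w := w) (z := z)) => [|v vw].
    by rewrite /z /y /= !inE eqxx (negPf wl).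
  by rewrite /z /y /= !inE (negPf vw).
have e0 : sum_prod A (y l (N :\ w)) = sum_prod A z - p * Z.
  rewrite (sum_prod_shift (w := w) (z := z)) => [|v vw].
    by rewrite /z /y /= !inE eqxx (negPf wl) /= mulr0n sub0r mulNr.
  by rewrite /z /y /= !inE (negPf vw).
have s1 : (N :&: W) :\: [set v in w :: l] \subset ((w |: N) :&: W) :\: [set v in l].
  apply/subsetP => v; rewrite !inE; case: (v == w) => //=.
have s0 : (N :&: W) :\: [set v in w :: l] = ((N :\ w) :&: W) :\: [set v in l].
  by apply/setP => v; rewrite !inE; case: (v == w); rewrite ?andbF //=.
rewrite /Ex_bit.
apply: le_trans (lerD (ler_wpM2l p0 (IH _ ul lW)) (ler_wpM2l q0 (IH _ ul lW))) _.
rewrite -s0 e1 e0.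
have [small|big] := leP (#|(N :&: W) :\: [set v in w :: l]|%:R : R) D; last first.
  rewrite !mul0r mulr0 addr0 (lt_geF (lt_le_trans big _)) ?mul0r ?mulr0 //.
  by rewrite ler_nat subset_leq_card.
rewrite !mul1r.
set r := 2 * p * (th * c) ^+ 2.
have Z0 : 0 <= Z by apply: sumr_ge0 => K _; apply: prodr_ge0 => v _; apply: z0.
have Zc : Z <= c.
  rewrite ler_pdivlMr ?ltr0n ?fact_gt0 // mulrC.
  apply: le_trans (ler_wpM2l (ler0n _ _) (sum_link_le w uA z0)) _.
  apply: le_trans (esym_le k W z0) _.
  rewrite lerXn2r ?nnegrE ?sumr_ge0 //; last first.
    by apply: le_trans (sum_y (w :: l) N) _; rewrite lerD2r.
  by rewrite addr_ge0 ?mulr_ge0 ?ler0n //; apply: le_trans small; apply: ler0n.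
have tZ : 0 <= th * Z <= 1 / 2.
  by rewrite mulr_ge0 //=; apply: le_trans thc; apply: ler_wpM2l.
apply: (@le_trans _ _ ((p * expR ((1 - p) * (th * Z)) + (1 - p) * expR (- p * (th * Z)))
   * expR (th * sum_prod A z + (size l)%:R * r))).
  rewrite [leRHS]mulrDl -![_ * _ * expR _]mulrA -!expRD lerD //.
    rewrite ler_wpM2l //; apply: le_trans (ler_piMl (expR_ge0 _) _) _.
      by rewrite lern1 leq_b1.
    rewrite ler_expR le_eqVlt; apply/orP; left; apply/eqP; ring.
  by rewrite ler_wpM2l // ler_expR le_eqVlt; apply/orP; left; apply/eqP; ring.
apply: le_trans (ler_wpM2r (expR_ge0 _) (bernoulli_mgf p01 tZ)) _.
rewrite -expRD ler_expR.
have : 2 * p * (th * Z) ^+ 2 <= r.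
  have c0 := le_trans Z0 Zc.
  rewrite /r ler_wpM2l ?mulr_ge0 // lerXn2r ?nnegrE ?(mulr_ge0 th0) //.
  exact: ler_wpM2l.
rewrite -(natr1 (size l)); lra.
Qed.

Lemma truncated_mgf :
  Ex (fun=> p) (fun N => (#|N :&: W|%:R <= D)%R%:R *
      expR (th * #|[set K in A | K \subset N]|%:R)) <=
  expR (th * (p ^+ k.+1 * #|A|%:R) + #|W|%:R * (2 * p * (th * c) ^+ 2)).
Proof.
rewrite -(Ex_foldr _ (enum W)); apply: Ex_le_cst => // N.
have /subsetP eW : {subset enum W <= W} by move=> w; rewrite mem_enum.
apply: le_trans (foldr_mgf N (enum_uniq W) _) _ => [w|]; first by rewrite mem_enum.
apply: le_trans (ler_piMl (expR_ge0 _) _) _; first by rewrite lern1 leq_b1.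
rewrite -cardE ler_expR lerD2r ler_wpM2l // /sum_prod.
rewrite mulrC mulr_natl -sumr_const; apply: ler_sum => K /(uniformP uA)[KW <-].
rewrite -prodr_const le_eqVlt; apply/orP; left; apply/eqP.
by apply: eq_bigr => w wK; rewrite /y mem_enum (subsetP KW).
Qed.

End TruncatedMgf.

End RandomSubset.

(** * Uncovered subsets *)

Section Neighbourhoods.
Variables (R : realType) (T : finType) (p : R) (W : {set T}).
Hypothesis p01 : 0 <= p <= 1.
Implicit Types (E : {set {set T}}) (A : {set {set T}}) (N K : {set T}).

Definition edge_weight (e : {set T}) : R := if #|e| == 2%N then p else 0.

Lemma edge_weight01 e : 0 <= edge_weight e <= 1.
Proof. by rewrite /edge_weight; case: ifP; rewrite ?lexx ?ler01. Qed.

Definition nb E (v : T) : {set T} := [set w in W | [set v; w] \in E].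

Definition star (v : T) : {set {set T}} := [set [set v; w] | w in W].

Lemma set2_inj (v : T) : v \notin W -> {in W &, injective (fun w => [set v; w])}.
Proof.
move=> vW w w' wW w'W /setP/(_ w); rewrite !inE eqxx orbT.
have /negPf -> : w != v by apply: contraNneq vW => <-.
by rewrite /= => /esym/eqP.
Qed.

Lemma Ex_nb v (f : {set T} -> R) : v \notin W ->
  Ex edge_weight (fun E => f (nb E v)) = Ex (fun=> p) (fun N => f (N :&: W)).
Proof.
move=> vW; apply: (Ex_preim (h := fun w => [set v; w])); first exact: set2_inj.
move=> w wW; rewrite /edge_weight cards2.
by have -> : v != w by apply: contraNneq vW => ->.
Qed.

Lemma Ex_peel v (G : {set T} -> {set {set T}} -> R) : v \notin W ->
  (forall N E E', E :\: star v = E' :\: star v -> G N E = G N E') ->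
  Ex edge_weight (fun E => G (nb E v) E) =
  Ex edge_weight (fun E1 => Ex edge_weight (fun E2 => G (nb E1 v) E2)).
Proof.
move=> vW GE; rewrite (Ex_resample _ (star v)).
apply: eq_Ex => E1; apply: eq_Ex => E2.
have -> : nb (E1 :&: star v :|: E2 :\: star v) v = nb E1 v.
  apply/setP => w; rewrite !inE; case: (boolP (w \in W)) => //= wW.
  have -> : [set v; w] \in star v by apply/imsetP; exists w.
  by rewrite andbT orbF.
by apply: GE; apply/setP => e; rewrite !inE; case: (e \in star v); rewrite ?andbF.
Qed.

Lemma nb_off v u E E' : u != v -> u \notin W ->
  E :\: star v = E' :\: star v -> nb E u = nb E' u.
Proof.
move=> uv uW EE'; apply/setP => w; rewrite !inE; congr (_ && _).
have us : [set u; w] \notin star v.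
  apply/imsetP => -[w' w'W /setP/(_ u)]; rewrite !inE eqxx (negPf uv) /=.
  by move=> /esym/eqP uw; rewrite uw w'W in uW.
by have /setP/(_ [set u; w]) := EE'; rewrite !inE us.
Qed.

Definition uncovered A (l : seq T) E :=
  [set K in A | all (fun v => ~~ (K \subset nb E v)) l].

Definition low_deg (D : R) (l : seq T) E := all (fun v => #|nb E v|%:R <= D) l.

Lemma uncovered_cons A v l E :
  uncovered A (v :: l) E = uncovered [set K in A | ~~ (K \subset nb E v)] l E.
Proof. by apply/setP => K; rewrite !inE /= andbA. Qed.

Lemma uncovered_off A v l E E' : v \notin l -> {in l, forall u, u \notin W} ->
  E :\: star v = E' :\: star v -> uncovered A l E = uncovered A l E'.
Proof.
move=> vl lW EE'; apply/setP => K; rewrite !inE; congr (_ && _).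
apply: eq_in_all => u ul; rewrite (nb_off (v := v) (E' := E')) ?lW //.
by apply: contraNneq vl => <-.
Qed.

Lemma low_deg_off D v l E E' : v \notin l -> {in l, forall u, u \notin W} ->
  E :\: star v = E' :\: star v -> low_deg D l E = low_deg D l E'.
Proof.
move=> vl lW EE'.
apply: eq_in_all => u ul; rewrite (nb_off (v := v) (E' := E')) ?lW //.
by apply: contraNneq vl => <-.
Qed.

Lemma uniform_sub k A A' : A' \subset A -> uniform k W A -> uniform k W A'.
Proof. by move=> /subsetP AA' /forall_inP u; apply/forall_inP => K /AA'/u. Qed.

Lemma card_covered k A N : uniform k W A ->
  (#|[set K in A | K \subset N]| <= 'C(#|N|, k))%N.
Proof.
move=> uA; rewrite -cards_draws; apply: subset_leq_card.
by apply/subsetP => K; rewrite !inE => /andP[/(uniformP uA)[_ ->] ->] /=.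
Qed.

Lemma card_uncovered1 A N : #|[set K in A | ~~ (K \subset N)]|%:R =
  #|A|%:R - #|[set K in A | K \subset N]|%:R :> R.
Proof.
apply/eqP; rewrite eq_sym subr_eq -natrD; apply/eqP; congr (_%:R).
rewrite -(cardsID [set K : {set T} | K \subset N] A) addnC; congr (_ + _)%N.
  by apply: eq_card => K; rewrite !inE andbC.
by apply: eq_card => K; rewrite !inE.
Qed.

Section Uncovered.
Variables (k : nat) (th D : R).
Hypothesis th0 : 0 <= th.
Let c := (D + p * #|W|%:R) ^+ k / k`!%:R.
Hypotheses (c0 : 0 <= c) (thc : th * c <= 1 / 2).
Let Q := 1 - p ^+ k.+1.
Let kap := #|W|%:R * (2 * p * (th * c) ^+ 2).

Let Q01 : 0 <= Q <= 1.
Proof.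
have /andP[p0 p1] := p01.
have h0 := exprn_ge0 k.+1 p0; have h1 := exprn_ile1 k.+1 p0 p1.
by rewrite /Q; lra.
Qed.

Let kap0 : 0 <= kap.
Proof.
have /andP[p0 _] := p01.
by apply: mulr_ge0 => //; apply: mulr_ge0; [apply: mulr_ge0 | apply: sqr_ge0].
Qed.

Lemma uncovered_typical l A : uniq l -> {in l, forall u, u \notin W} ->
  uniform k.+1 W A ->
  Ex edge_weight (fun E => (low_deg D l E)%:R * expR (- th * #|uncovered A l E|%:R))
  <= expR (- th * (Q ^+ size l * #|A|%:R) + (size l)%:R * kap).
Proof.
have [Q0 Q1] := andP Q01; have [p0 p1] := andP p01.
elim: l A => [|v l IH] A /=.
  move=> _ _ _; apply: Ex_le_cst => E; first exact: edge_weight01.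
  rewrite mul1r expr0 mul1r mul0r addr0.
  by rewrite (_ : uncovered A [::] E = A) //; apply/setP => K; rewrite inE andbT.
move=> /andP[vl ul] lW uA.
have vW : v \notin W by apply: lW; rewrite inE eqxx.
have {}lW : {in l, forall u, u \notin W} by move=> u ul'; apply: lW; rewrite inE ul' orbT.
pose G N E := (#|N|%:R <= D)%R%:R * ((low_deg D l E)%:R *
  expR (- th * #|uncovered [set K in A | ~~ (K \subset N)] l E|%:R)).
have -> : Ex edge_weight (fun E => (low_deg D (v :: l) E)%:R *
    expR (- th * #|uncovered A (v :: l) E|%:R)) = Ex edge_weight (fun E => G (nb E v) E).
  by apply: eq_Ex => E; rewrite uncovered_cons /= -mulnb natrM -mulrA.
rewrite Ex_peel //; last first.
  move=> N E E' EE'; rewrite /G (uncovered_off _ vl lW EE').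
  by rewrite (low_deg_off _ vl lW EE').
set r := size l.
pose th' := th * Q ^+ r.
have th'0 : 0 <= th' by rewrite mulr_ge0 ?exprn_ge0.
have th'th : th' <= th by rewrite ler_piMr // exprn_ile1.
have th'c : th' * c <= 1 / 2 by apply: le_trans thc; rewrite ler_wpM2r.
pose F N := (#|N|%:R <= D)%R%:R * expR (th' * #|[set K in A | K \subset N]|%:R).
apply: (@le_trans _ _ (Ex edge_weight (fun E =>
    expR (- th' * #|A|%:R + r%:R * kap) * F (nb E v)))).
  apply: le_Ex => [|E]; first exact: edge_weight01.
  rewrite ExZ mulrCA ler_wpM2l ?ler0n //.
  apply: le_trans (IH _ ul lW (uniform_sub _ uA)) _.
    by apply/subsetP => K; rewrite inE => /andP[].
  rewrite card_uncovered1 -expRD ler_expR /th' /r.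
  by rewrite le_eqVlt; apply/orP; left; apply/eqP; ring.
rewrite ExZ Ex_nb //.
have := truncated_mgf uA p01 th'0 th'c.
set rhs := expR (_ + _) => H.
have {}H : Ex (fun=> p) (fun N => F (N :&: W)) <= rhs.
  apply: le_trans H; rewrite le_eqVlt; apply/orP; left; apply/eqP.
  apply: eq_Ex => N; rewrite /F; congr (_ * expR (_ * _%:R)).
  apply: eq_card => K; rewrite !inE; case: (boolP (K \in A)) => //= KA.
  by rewrite subsetI (uniformP uA KA).1 andbT.
apply: le_trans (ler_wpM2l (expR_ge0 _) H) _.
rewrite /rhs -expRD ler_expR.
have : #|W|%:R * (2 * p * (th' * c) ^+ 2) <= kap.
  rewrite !ler_wpM2l ?mulr_ge0 ?ler0n // lerXn2r ?nnegrE ?(mulr_ge0 th0) ?(mulr_ge0 th'0) //.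
  exact: ler_wpM2r.
rewrite [Q ^+ r.+1]exprS -(natr1 r) => h.
have -> : - th * (Q * Q ^+ r * #|A|%:R) =
    - th' * #|A|%:R + th' * (p ^+ k.+1 * #|A|%:R) by rewrite /th' {1}/Q; ring.
have aux (X kp a b : R) : X <= kp -> a + r%:R * kp + (b + X) <= a + b + (r%:R + 1) * kp.
  by move=> Xkp; lra.
exact: aux.
Qed.

Variables (m : nat) (phi eta cap : R).
Hypotheses (phi0 : 0 <= phi) (phith : phi <= th * Q ^+ m).
Hypothesis exceptional :
  Ex (fun=> p) (fun N => (D < #|N :&: W|%:R <= cap)%R%:R *
                         expR (phi * 'C(#|N :&: W|, k.+1)%:R)) <= eta.

(* Vertices of exceptionally large degree into [W] are integrated out before
   the typical ones, so that they act on [A] with the small parameter [phi]. *)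
Lemma uncovered_mgf us vs A : uniq (us ++ vs) ->
  {in us ++ vs, forall u, u \notin W} -> (size us + size vs <= m)%N ->
  uniform k.+1 W A ->
  Ex edge_weight (fun E => (low_deg cap us E)%:R * ((low_deg D vs E)%:R *
     expR (- th * #|uncovered A (us ++ vs) E|%:R)))
  <= (1 + eta) ^+ size us * expR (- phi * #|A|%:R + m%:R * kap).
Proof.
have [Q0 Q1] := andP Q01; have [p0 p1] := andP p01.
elim: us vs A => [|u us IH] vs A.
  rewrite /= => uvs vsW sm uA.
  rewrite expr0 mul1r (eq_Ex _ (g := fun E => (low_deg D vs E)%:R *
      expR (- th * #|uncovered A vs E|%:R))); last by move=> E; rewrite mul1r.
  apply: le_trans (uncovered_typical uvs vsW uA) _.
  rewrite ler_expR lerD //; last by rewrite ler_wpM2r // ler_nat.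
  rewrite !mulNr lerN2 mulrA ler_wpM2r ?ler0n //.
  apply: le_trans phith _; rewrite ler_wpM2l //.
  exact: ler_wiXn2l.
move=> uq uvsW sm uA.
have eta0 : 0 <= eta.
  apply: le_trans exceptional; apply: Ex_ge0 => [_ //|N].
  by rewrite mulr_ge0 ?ler0n ?expR_ge0.
have [unot uq'] : u \notin us ++ vs /\ uniq (us ++ vs) by move: uq => /= /andP.
have uW : u \notin W by apply: uvsW; rewrite inE eqxx.
have W' : {in us ++ vs, forall u, u \notin W} by move=> v vi; apply: uvsW; rewrite inE vi orbT.
have usW : {in us, forall u, u \notin W} by move=> v vi; apply: W'; rewrite mem_cat vi.
have vsW : {in vs, forall u, u \notin W} by move=> v vi; apply: W'; rewrite mem_cat vi orbT.
have [unus unvs] : u \notin us /\ u \notin vs.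
  by move: unot; rewrite mem_cat negb_or => /andP.
have sm' : (size us + size vs <= m)%N by apply: leq_trans sm; rewrite leq_add2r /=.
pose G N E := (D < #|N|%:R <= cap)%R%:R * ((low_deg cap us E)%:R * ((low_deg D vs E)%:R *
     expR (- th * #|uncovered [set K in A | ~~ (K \subset N)] (us ++ vs) E|%:R))).
apply: (@le_trans _ _ (Ex edge_weight (fun E =>
   (low_deg cap us E)%:R * ((low_deg D (u :: vs) E)%:R *
     expR (- th * #|uncovered A (us ++ u :: vs) E|%:R)) + G (nb E u) E))).
  apply: le_Ex => [|E]; first exact: edge_weight01.
  have -> : uncovered A (us ++ u :: vs) E = uncovered A ((u :: us) ++ vs) E.
    by apply/setP => K; rewrite !inE /= !all_cat /=; congr (_ && _); rewrite andbCA.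
  rewrite /G -uncovered_cons.
  set e := expR _; have e0 : 0 <= e by apply: expR_ge0.
  rewrite /= !mulrA -!natrM !mulnb -mulrDl ler_wpM2r // -natrD ler_nat.
  by case: (leP _ D) => _ /=; case: (low_deg cap us E); case: (low_deg D vs E);
     case: (_ <= cap)%R.
rewrite ExD /= exprS mulrDl mul1r mulrDl lerD //.
  apply: (IH (u :: vs) A) => //; last by rewrite /= addnS -addSn.
    by rewrite -[u :: vs]cat1s uniq_catCA.
  by move=> v; rewrite mem_cat inE orbCA -mem_cat => /= vi; apply: uvsW; rewrite inE.
rewrite Ex_peel //; last first.
  move=> N E E' EE'; rewrite /G (uncovered_off _ unot W' EE').
  by rewrite (low_deg_off _ unus usW EE') (low_deg_off _ unvs vsW EE').
set B := (1 + eta) ^+ size us.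
have B0 : 0 <= B by rewrite exprn_ge0 // addr_ge0.
pose F N := (D < #|N|%:R <= cap)%R%:R * expR (phi * 'C(#|N|, k.+1)%:R).
apply: (@le_trans _ _ (Ex edge_weight (fun E =>
    (B * expR (- phi * #|A|%:R + m%:R * kap)) * F (nb E u)))).
  apply: le_Ex => [|E]; first exact: edge_weight01.
  rewrite ExZ /F mulrCA ler_wpM2l ?ler0n //.
  apply: le_trans (IH _ _ uq' W' sm' (uniform_sub _ uA)) _.
    by apply/subsetP => K; rewrite inE => /andP[].
  rewrite -mulrA ler_wpM2l // -expRD ler_expR card_uncovered1.
  have : #|[set K in A | K \subset nb E u]|%:R <= 'C(#|nb E u|, k.+1)%:R :> R.
    by rewrite ler_nat card_covered.
  by move=> /(ler_wpM2l phi0); lra.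
rewrite ExZ Ex_nb // mulrC -[leRHS]mulrA ler_wpM2r //.
by rewrite mulr_ge0 ?expR_ge0.
Qed.

End Uncovered.
End Neighbourhoods.

(** * Numerical estimates *)

Section Estimates.
Variable R : realType.

Lemma expR1_le4 : expR 1 <= 4 :> R.
Proof.
have h : expR (1 / 2) <= 2 :> R by apply: le_trans (expR_le_quad _) _; lra.
have -> : 1 = 2%:R * (1 / 2) :> R by lra.
rewrite expRM_natl; have := expR_ge0 (1 / 2 : R); nra.
Qed.

Lemma powD_le_fact (d : nat) : d%:R ^+ d <= expR d%:R * d`!%:R :> R.
Proof.
case: d => [|d]; first by rewrite expr0 expR0 mul1r.
rewrite -ler_pdivrMr ?ltr0n ?fact_gt0 //.
by apply: le_trans (expR_ge1Dxn d (ler0n R d.+1)); rewrite lerDr.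
Qed.

Lemma ffact_le_pow (m i : nat) : (m ^_ i)%:R <= m%:R ^+ i :> R.
Proof.
rewrite -natrX ler_nat; elim: i => // i IH.
by rewrite ffactnSr expnSr leq_mul ?leq_subr.
Qed.

Lemma bin_le_pow (s d : nat) : 'C(s, d)%:R * d`!%:R <= s%:R ^+ d :> R.
Proof. by rewrite -natrM bin_ffact ffact_le_pow. Qed.

Lemma bin_le_expR (s d : nat) : (0 < d)%N ->
  'C(s, d)%:R <= (expR 1 * (s%:R / d%:R)) ^+ d :> R.
Proof.
move=> d0; have d0' : 0 < d%:R :> R by rewrite ltr0n.
rewrite exprMn expr_div_n -expRM_natl mulr1 mulrA ler_pdivlMr ?exprn_gt0 //.
apply: le_trans (ler_wpM2l (ler0n _ _) (powD_le_fact d)) _.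
by rewrite mulrCA ler_wpM2l ?expR_ge0 ?bin_le_pow.
Qed.

Lemma pow_le_bin (s k : nat) : (2 * k ^ 2 <= s)%N ->
  s%:R ^+ k <= 2 * ('C(s, k)%:R * k`!%:R) :> R.
Proof.
case: (posnP k) => [->|k0 ks]; first by rewrite expr0 bin0 fact0 mulr1; lra.
have s0 : 0 < s%:R :> R by rewrite ltr0n; lia.
rewrite -natrM bin_ffact.
have H i : (i <= k)%N -> s%:R ^+ i * (1 - (i * k)%:R / s%:R) <= (s ^_ i)%:R :> R.
  elim: i => [|i IH] ik; first by rewrite mul0n mul0r subr0 mulr1.
  have {}IH := IH (ltnW ik).
  have is_ : (i <= s)%N by nia.
  rewrite ffactnSr [(_ * (s - i))%:R]natrM natrB //.
  have si0 : 0 <= s%:R - i%:R :> R by rewrite subr_ge0 ler_nat.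
  apply: le_trans (ler_wpM2r si0 IH).
  rewrite !natrM -(natr1 i) exprSr.
  have ik' : i%:R <= k%:R :> R by rewrite ler_nat ltnW.
  have -> : s%:R ^+ i * (1 - i%:R * k%:R / s%:R) * (s%:R - i%:R) =
    s%:R ^+ i * s%:R * (1 - (i%:R + 1) * k%:R / s%:R) +
    s%:R ^+ i * (k%:R - i%:R + i%:R * i%:R * k%:R / s%:R) :> R.
    by field; rewrite lt0r_neq0.
  rewrite lerDl mulr_ge0 ?exprn_ge0 // addr_ge0 ?subr_ge0 //.
apply: le_trans (ler_wpM2l (ler0n _ 2) (H k (leqnn _))).
have : (k * k)%:R / s%:R <= 1 / 2 :> R.
  rewrite ler_pdivrMr // mul1r ler_pdivlMl // -natrM ler_nat; lia.
have : 0 <= s%:R ^+ k :> R by rewrite exprn_ge0.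
move: (s%:R ^+ k) (_ / _) => a b; nra.
Qed.

Lemma ln_inv_le_sqrt (r : R) : 0 < r -> - ln r <= 2 / Num.sqrt r.
Proof.
move=> r0; have s0 : 0 < Num.sqrt r by rewrite sqrtr_gt0.
have -> : ln r = ln (Num.sqrt r) *+ 2 by rewrite -lnXn // sqr_sqrtr // ltW.
have := ln_sublinear (x := (Num.sqrt r)^-1); rewrite invr_gt0 => /(_ s0).
by rewrite lnV ?posrE // => h; rewrite mulr2n; lra.
Qed.

Lemma exceptional_rate (p r : R) : 0 < p -> 64 * p <= r -> r <= 8 / 1000 ^+ 2 ->
  expR (16 * - ln p * r) * (expR 1 * (p / r)) <= expR (- 1).
Proof.
move=> p0 pr rs; have r0 : 0 < r by lra.
have -> : p / r = expR (ln p - ln r) by rewrite expRB !lnK ?posrE.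
rewrite -!expRD ler_expR.
have h3 : 3 <= ln r - ln p.
  rewrite -ln_div ?posrE // -(ler_expR 3) lnK ?posrE ?divr_gt0 //.
  rewrite ler_pdivlMr //; apply: le_trans pr; rewrite ler_wpM2r ?(ltW p0) //.
  rewrite -[3]mulr1 expRM_natl; have := expR1_le4; have := expR_ge0 (1 : R).
  move: (expR 1) => e e0 e4.
  have : e ^+ 3 <= 4 ^+ 3 by rewrite lerXn2r ?nnegrE.
  lra.
have sr : Num.sqrt r <= 1 / 250.
  have := sqr_sqrtr (ltW r0); have := sqrtr_ge0 r.
  by move: (Num.sqrt r) => x x0 xr; rewrite leNgt; apply/negP => x1; nra.
have h4 : r * - ln r <= 2 * Num.sqrt r.
  apply: le_trans (ler_wpM2l (ltW r0) (ln_inv_le_sqrt r0)) _.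
  rewrite -{1}(sqr_sqrtr (ltW r0)) expr2 mulrCA -mulrA mulfV ?mulr1 //.
  by rewrite lt0r_neq0 // sqrtr_gt0.
have h5 : r * (ln r - ln p) <= (ln r - ln p) / 1000.
  by rewrite mulrC ler_wpM2l; lra.
lra.
Qed.

End Estimates.

Section Regime.
Variables (R : realType) (n j s : nat) (p : R).
Let L : R := - ln p.
Let Qn : R := (1 - p ^+ j.+1) ^+ n.

(* Here [k = j.+1] and [C = 1000]; the hypotheses of the theorem and the choice of
   [s] are raised to integer powers so that only natural exponents remain. *)
Record regime : Prop := Regime {
  reg_j : (0 < j)%N;
  reg_p0 : 0 < p;
  reg_p : 6000 * p < 1;
  reg_np : 1 <= n%:R * p;
  reg_L : L <= n%:R * p;
  reg_sn : (s <= n)%N;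
  reg_fluct : (6000 * p) ^+ (2 * j) * j.+1%:R ^+ 2 * L * (n%:R * p) <= Qn ^+ 2;
  reg_edge : 125 * 1000 * j.+1%:R ^+ 5 * L <= s%:R * p * Qn;
  reg_clique : (1000 ^+ 2) ^+ j * (j.+1`!%:R * j.+1%:R * L)
               <= s%:R ^+ j * p ^+ 'C(j.+1, 2) * Qn;
  reg_s : 1000 ^+ 2 * (n%:R * p) <= s%:R }.

Hypothesis reg : regime.

Let p0 : 0 < p := reg_p0 reg.
Let p1 : p <= 1. Proof. by have := reg_p reg; have := p0; lra. Qed.

Lemma regime_p01 : 0 <= p <= 1.
Proof. by rewrite (ltW p0). Qed.

Lemma regime_L1 : 1 <= L.
Proof.
rewrite -(ler_expR 1) /L expRN lnK ?posrE //.
apply: le_trans (expR1_le4 _) _; rewrite -[leRHS]mul1r ler_pdivlMr //.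
by have := reg_p reg; have := p0; lra.
Qed.

Lemma regime_expL : expR (- L) = p.
Proof. by rewrite opprK lnK. Qed.

Let Q01 : 0 < 1 - p ^+ j.+1 <= 1.
Proof.
rewrite subr_gt0 exprn_ilt1 ?(ltW p0) //=; last by have := reg_p reg; have := p0; lra.
by rewrite lerBlDr lerDl exprn_ge0 // ltW.
Qed.

Lemma regime_Qn01 : 0 < Qn <= 1.
Proof.
have /andP[q0 q1] := Q01.
by rewrite exprn_gt0 //= exprn_ile1 // ltW.
Qed.

Let k5 : 32 <= j.+1%:R ^+ 5 :> R.
Proof.
have -> : 32 = 2 ^+ 5 :> R by lra.
by rewrite lerXn2r ?nnegrE ?ler0n // ler_nat ltnS (reg_j reg).
Qed.

Lemma regime_sp : 125 * 1000 * j.+1%:R ^+ 5 * L <= s%:R * p.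
Proof.
apply: le_trans (reg_edge reg) _; have /andP[q0 q1] := regime_Qn01.
by rewrite ler_piMr // mulr_ge0 ?ler0n // ltW.
Qed.

Lemma regime_s_gt0 : 0 < s%:R :> R.
Proof. have := reg_s reg; have := reg_np reg; lra. Qed.

Lemma regime_s_large : (2 * j.+1 ^ 2 <= s)%N.
Proof.
rewrite -(ler_nat R) natrM natrX.
have h1 := regime_sp; have h2 := regime_L1; have h3 := k5.
have h4 : s%:R * p <= s%:R :> R by rewrite ler_piMr ?ler0n.
have h5 : j.+1%:R ^+ 5 <= j.+1%:R ^+ 5 * L :> R by rewrite ler_peMr ?exprn_ge0.
have h6 : j.+1%:R ^+ 2 <= j.+1%:R ^+ 5 :> R by rewrite ler_weXn2l // ler1n.
lra.
Qed.

Let M : R := 'C(s, j.+1)%:R.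

Lemma regime_M : s%:R ^+ j.+1 <= 2 * (M * j.+1`!%:R).
Proof. exact/pow_le_bin/regime_s_large. Qed.

Lemma regime_M_gt0 : 0 < M.
Proof.
have s0 := exprn_gt0 j.+1 regime_s_gt0; have := lt_le_trans s0 regime_M.
by rewrite pmulr_rgt0 // pmulr_lgt0 // ltr0n fact_gt0.
Qed.

Definition tilt : R := 8 * s%:R * L / M.

Let tilt0 : 0 <= tilt.
Proof.
have := regime_L1 => L1.
rewrite divr_ge0 ?ler0n // mulr_ge0 ?ler0n // ?mulr_ge0 ?ler0n //; lra.
Qed.

Lemma tilt_le : tilt <= 16 * s%:R * L * j.+1`!%:R / s%:R ^+ j.+1.
Proof.
have L1 := regime_L1; have M0 := regime_M_gt0; have s0 := regime_s_gt0.
rewrite /tilt ler_pdivrMr // [leRHS]mulrAC ler_pdivlMr ?exprn_gt0 //.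
have sL : 0 <= 8 * s%:R * L by rewrite !mulr_ge0 ?ler0n //; lra.
have := ler_wpM2l sL regime_M; lra.
Qed.

Lemma tilt_bin (d : nat) : (d <= s)%N ->
  tilt * 'C(d, j.+1)%:R <= d%:R * (16 * L * (d%:R / s%:R)).
Proof.
move=> ds; have L1 := regime_L1; have s0 := regime_s_gt0.
have r1 : d%:R / s%:R <= 1 :> R by rewrite ler_pdivrMr // mul1r ler_nat.
have r0 : 0 <= d%:R / s%:R :> R by rewrite divr_ge0 ?ler0n.
apply: le_trans (ler_wpM2r (ler0n _ _) tilt_le) _.
have -> : 16 * s%:R * L * j.+1`!%:R / s%:R ^+ j.+1 * 'C(d, j.+1)%:R =
  16 * s%:R * L * ('C(d, j.+1)%:R * j.+1`!%:R / s%:R ^+ j.+1) by ring.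
have h : 'C(d, j.+1)%:R * j.+1`!%:R / s%:R ^+ j.+1 <= (d%:R / s%:R) ^+ 2 :> R.
  apply: (@le_trans _ _ ((d%:R / s%:R) ^+ j.+1)).
    by rewrite expr_div_n ler_wpM2r ?invr_ge0 ?exprn_ge0 ?bin_le_pow.
  by rewrite ler_wiXn2l // ltnS (reg_j reg).
have sL : 0 <= 16 * s%:R * L by rewrite !mulr_ge0 ?ler0n //; lra.
apply: le_trans (ler_wpM2l sL h) _.
by rewrite le_eqVlt; apply/orP; left; apply/eqP; field; rewrite lt0r_neq0.
Qed.

Lemma exceptional_mgf (T : finType) (W : {set T}) : #|W| = s ->
  Ex (fun=> p) (fun N => (64 * s%:R * p < #|N :&: W|%:R <= 8 * (n%:R * p))%R%:R *
                         expR (tilt * 'C(#|N :&: W|, j.+1)%:R))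
  <= s.+1%:R * expR (- (64 * s%:R * p)).
Proof.
move=> cW; have s0 := regime_s_gt0.
pose D := 64 * s%:R * p.
pose g d : R := (D < d%:R <= 8 * (n%:R * p))%R%:R * expR (tilt * 'C(d, j.+1)%:R).
have g0 d : 0 <= g d by rewrite mulr_ge0 ?ler0n ?expR_ge0.
apply: (@le_trans _ _ (Ex (fun=> p) (fun N =>
   \sum_(d < s.+1) g d * (d <= #|N :&: W|)%N%:R))).
  apply: le_Ex => [_|N]; first exact: regime_p01.
  have ds : (#|N :&: W| < s.+1)%N by rewrite ltnS -cW subset_leq_card ?subsetIr.
  rewrite (bigD1 (Ordinal ds)) //= leqnn mulr1 lerDl.
  by apply: sumr_ge0 => d _; rewrite mulr_ge0 ?ler0n.
rewrite Ex_sum mulr_natl -[X in _ *+ X]card_ord -sumr_const; apply: ler_sum => d _.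
rewrite ExZ; apply: le_trans (ler_wpM2l (g0 d) (Ex_card_ge _ _ _ (x := p) _)) _ => //.
  by move=> _; apply: regime_p01.
rewrite cW /g; case: andP => [[Dd dc]|_]; last by rewrite !mul0r expR_ge0.
rewrite mul1r.
have d0 : 0 < d%:R :> R.
  by apply: le_lt_trans Dd; rewrite /D !mulr_ge0 ?ler0n // ltW.
have d0' : (0 < d)%N by rewrite -(ltr0n R).
set r := d%:R / s%:R : R.
have r1 : 64 * p <= r by rewrite ler_pdivlMr //; move: Dd; rewrite /D; lra.
have r2 : r <= 8 / 1000 ^+ 2.
  by rewrite ler_pdivrMr //; have := reg_s reg; lra.
apply: (@le_trans _ _ ((expR (16 * - ln p * r) * (expR 1 * (p / r))) ^+ d)).
  have -> : p / r = s%:R / d%:R * p by rewrite /r; field; rewrite !lt0r_neq0.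
  rewrite exprMn [expR 1 * _]mulrA [(_ * p) ^+ d]exprMn.
  apply: ler_pM; rewrite ?expR_ge0 ?mulr_ge0 ?exprn_ge0 ?ler0n ?(ltW p0) //.
    rewrite -expRM_natl ler_expR; apply: tilt_bin.
    by rewrite -ltnS ltn_ord.
  by rewrite ler_wpM2r ?exprn_ge0 ?(ltW p0) // bin_le_expR.
apply: (@le_trans _ _ (expR (- 1) ^+ d)).
  rewrite lerXn2r ?nnegrE ?expR_ge0 ?exceptional_rate //.
  by rewrite !mulr_ge0 ?expR_ge0 ?invr_ge0 ?divr_ge0 ?ler0n // ltW.
by rewrite -expRM_natl ler_expR; move: Dd; rewrite /D; lra.
Qed.

Lemma exceptional_total :
  n%:R * (s.+1%:R * expR (- (64 * s%:R * p))) <= s%:R * L / 2.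
Proof.
have L1 := regime_L1; have s0 := regime_s_gt0; have /andP[q0 q1] := regime_Qn01.
have k1 : 1 <= j.+1%:R :> R by rewrite ler1n.
have nL : n%:R <= expR ((2 * j + 1)%:R * L).
  rewrite mulrC expRM_natr -[expR L]invrK -expRN regime_expL exprVn.
  rewrite -[leRHS]mul1r ler_pdivlMr ?exprn_gt0 //.
  apply: le_trans (le_trans (reg_fluct reg) (_ : Qn ^+ 2 <= 1)); last first.
    by rewrite exprn_ile1 // ltW.
  rewrite exprD expr1 exprMn mulrCA -!mulrA.
  have h : 1 <= 6000 ^+ (2 * j) * (j.+1%:R ^+ 2 * L) :> R.
    have a1 : 1 <= 6000 ^+ (2 * j) :> R by rewrite exprn_ege1 //; lra.
    have a2 : 1 <= j.+1%:R ^+ 2 :> R by rewrite exprn_ege1.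
    by rewrite mulr_ege1 // mulr_ege1.
  have pp : 0 <= p ^+ (2 * j) * (n%:R * p) by rewrite !mulr_ge0 ?exprn_ge0 ?(ltW p0).
  have := ler_wpM2r pp h; lra.
have sp : (2 * j + 1)%:R * L + 3 <= 64 * s%:R * p.
  have h := regime_sp.
  have k5j : j.+1%:R <= j.+1%:R ^+ 5 :> R.
    by rewrite -[leLHS]expr1 ler_weXn2l.
  have := ler_wpM2r (le_trans ler01 L1) k5j.
  have -> : (2 * j + 1)%:R = 2 * j.+1%:R - 1 :> R by rewrite natrD natrM -natr1; ring.
  have kL : 1 <= j.+1%:R * L by rewrite mulr_ege1.
  lra.
have e3 : 4 <= expR 3 :> R by apply: le_trans (expR_ge1Dx _); lra.
have h : 4 * n%:R * expR (- (64 * s%:R * p)) <= 1.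
  rewrite expRN ler_pdivrMr ?expR_gt0 // mul1r.
  apply: (@le_trans _ _ (expR ((2 * j + 1)%:R * L + 3))); last by rewrite ler_expR.
  by rewrite expRD mulrC ler_pM ?ler0n.
have s1 : s.+1%:R <= 2 * s%:R :> R.
  by rewrite -(natr1 s); have := reg_s reg; have := reg_np reg; lra.
have e0 : 0 <= n%:R * expR (- (64 * s%:R * p)) by rewrite mulr_ge0 ?expR_ge0 ?ler0n.
have h2 := ler_wpM2r e0 s1.
have h3 : s%:R * (4 * n%:R * expR (- (64 * s%:R * p))) <= s%:R by rewrite ler_piMr // ltW.
have h4 : s%:R <= s%:R * L by rewrite ler_peMr // ltW.
move: (expR _) h2 h3 => e h2 h3; lra.
Qed.

Definition tilt_out : R := tilt / Qn.

Let c : R := (64 * s%:R * p + p * s%:R) ^+ j / j`!%:R.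

Let c0 : 0 <= c.
Proof.
by rewrite divr_ge0 ?ler0n // exprn_ge0 // addr_ge0 ?mulr_ge0 ?ler0n // ltW.
Qed.

Let tilt_out0 : 0 <= tilt_out.
Proof. by have /andP[q0 _] := regime_Qn01; rewrite divr_ge0 // ltW. Qed.

Lemma tilt_out_sq : n%:R * p * (tilt_out * c) ^+ 2 <= L / 30.
Proof.
have L1 := regime_L1; have s0 := regime_s_gt0; have /andP[q0 q1] := regime_Qn01.
have np0 : 0 <= n%:R * p by rewrite mulr_ge0 ?ler0n // ltW.
pose u := 16 * L * j.+1%:R * (65 * p) ^+ j / Qn.
have tu : tilt_out * c <= u.
  rewrite /tilt_out mulrAC /u ler_wpM2r ?invr_ge0 ?(ltW q0) //.
  apply: le_trans (ler_wpM2r c0 tilt_le) _; rewrite /c.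
  have -> : 64 * s%:R * p + p * s%:R = s%:R * (65 * p) by ring.
  rewrite exprMn factS natrM exprS le_eqVlt; apply/orP; left; apply/eqP; field.
  by rewrite pnatr_eq0 -lt0n fact_gt0 expf_neq0 lt0r_neq0.
have u0 : 0 <= u.
  by rewrite divr_ge0 ?(ltW q0) // !mulr_ge0 ?exprn_ge0 ?mulr_ge0 ?ler0n ?(ltW p0) //; lra.
apply: (@le_trans _ _ (n%:R * p * u ^+ 2)).
  rewrite ler_wpM2l // lerXn2r ?nnegrE ?(mulr_ge0 tilt_out0 c0) //.
rewrite /u expr_div_n mulrA ler_pdivrMr ?(exprn_gt0 2 q0) //.
have L30 : 0 <= L / 30 by lra.
apply: le_trans (ler_wpM2l L30 (reg_fluct reg)).
have c65 : 8000 * (65 * p) ^+ (2 * j) <= (6000 * p) ^+ (2 * j).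
  have p20 : 0 <= (65 * p) ^+ 2 by rewrite exprn_ge0 // mulr_ge0 ?ler0n // ltW.
  rewrite !exprM.
  have -> : (6000 * p) ^+ 2 = (6000 / 65) ^+ 2 * (65 * p) ^+ 2 by field.
  move: p20; move: ((65 * p) ^+ 2) => X X0.
  rewrite [leRHS]exprMn; apply: ler_wpM2r; first by rewrite exprn_ge0.
  apply: (@le_trans _ _ (((6000 / 65) ^+ 2) ^+ 1)); first by rewrite expr1; lra.
  by rewrite ler_weXn2l ?(reg_j reg) //; lra.
have pos : 0 <= j.+1%:R ^+ 2 * L * (n%:R * p) * L.
  by rewrite !mulr_ge0 ?exprn_ge0 ?ler0n ?(ltW p0) //; lra.
rewrite !exprMn -!exprM [(j * 2)%N]mulnC.
have := ler_wpM2l pos c65; rewrite !exprMn.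
have a0 : 0 <= j.+1%:R ^+ 2 * L * (n%:R * p) * L * (65 ^+ (2 * j) * p ^+ (2 * j)).
  by rewrite !mulr_ge0 ?exprn_ge0 ?ler0n ?(ltW p0) //; lra.
move: a0; move: (65 ^+ _) (6000 ^+ _) (p ^+ _) (j.+1%:R ^+ 2) => a b x y; lra.
Qed.

Lemma tilt_out_small : tilt_out * c <= 1 / 2.
Proof.
have h := tilt_out_sq; have np1 := reg_np reg; have Lnp := reg_L reg.
have t0 : 0 <= tilt_out * c by rewrite mulr_ge0.
rewrite leNgt; apply/negP => t1.
have h4 : 1 / 4 < (tilt_out * c) ^+ 2.
  have -> : 1 / 4 = (1 / 2) ^+ 2 :> R by field.
  by rewrite ltrXn2r ?nnegrE //; lra.
have np0 : 0 < n%:R * p by lra.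
have : n%:R * p * (1 / 4) < n%:R * p * (tilt_out * c) ^+ 2 by rewrite ltr_pM2l.
by move: (_ ^+ 2) h {h4} => x h; lra.
Qed.

Lemma typical_total : n%:R * (s%:R * (2 * p * (tilt_out * c) ^+ 2)) <= s%:R * L / 2.
Proof.
have s0 := ltW regime_s_gt0.
have := ler_wpM2l s0 tilt_out_sq; have L1 := regime_L1.
have : 0 <= s%:R * L by rewrite mulr_ge0 //; lra.
move: (_ ^+ 2) => x; lra.
Qed.

End Regime.

Section CliqueRegime.
Variables (R : realType) (n j s : nat) (p : R).
Hypothesis reg : regime n j s p.
Let L : R := - ln p.
Let Qn : R := (1 - p ^+ j.+1) ^+ n.
Let p0 : 0 < p. Proof. exact: reg_p0 reg. Qed.

Let bin2_double m : (2 * 'C(m.+1, 2) = m.+1 * m)%N.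
Proof. by rewrite -mul_bin_diag bin1. Qed.

Let Qn01 : 0 < Qn <= 1. Proof. exact: regime_Qn01 reg. Qed.
Let L1 : 1 <= L. Proof. exact: regime_L1 reg. Qed.
Let L0 : 0 <= L. Proof. by have := L1; lra. Qed.

Lemma clique_base : (625 * 100 * j.+1%:R) ^+ 2 <= s%:R ^+ 2 * p ^+ j.+1.
Proof.
have /andP[q0 q1] := Qn01; have s0 := regime_s_gt0 reg; have j0 := reg_j reg.
rewrite leNgt; apply/negP => small.
have x0 : 0 <= s%:R ^+ 2 * p ^+ j.+1 by rewrite mulr_ge0 ?exprn_ge0 ?ler0n // ltW.
have : (s%:R ^+ 2 * p ^+ j.+1) ^+ j < ((625 * 100 * j.+1%:R) ^+ 2) ^+ j.
  by rewrite ltrXn2r // -lt0n.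
apply/negP; rewrite -leNgt.
have k16 : j.+1%:R ^+ j <= 16 ^+ j * j.+1`!%:R :> R.
  apply: (@le_trans _ _ (j.+1%:R ^+ j.+1)); first by rewrite ler_weXn2l // ler1n.
  apply: le_trans (powD_le_fact _ _) _; rewrite ler_wpM2r ?ler0n //.
  rewrite -[j.+1%:R]mulr1 expRM_natl.
  apply: (@le_trans _ _ (4 ^+ j.+1)).
    by rewrite lerXn2r ?nnegrE ?expR_ge0 ?expR1_le4.
  have -> : 16 = 4 ^+ 2 :> R by rewrite expr2 -natrM.
  by rewrite -exprM ler_weXn2l ?ler1n //; lia.
apply: (@le_trans _ _ (((1000 ^+ 2) ^+ j * (j.+1`!%:R * j.+1%:R * L)) ^+ 2)).
  rewrite exprAC lerXn2r ?nnegrE ?exprn_ge0 ?mulr_ge0 ?exprn_ge0 ?ler0n //.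
  rewrite exprMn (_ : 1000 ^+ 2 = 625 * 100 * 16 :> R); last by ring.
  rewrite [leRHS]mulrA [(_ * 16) ^+ j]exprMn -!mulrA ler_wpM2l ?exprn_ge0 ?mulr_ge0 ?ler0n //.
  apply: le_trans k16 _; rewrite ler_wpM2l ?exprn_ge0 // ler_peMr ?ler0n //.
  by rewrite mulr_ege1 // ler1n.
have h0 : 0 <= (1000 ^+ 2) ^+ j * (j.+1`!%:R * j.+1%:R * L).
  by rewrite !mulr_ge0 ?exprn_ge0 ?ler0n //; lra.
apply: (@le_trans _ _ ((s%:R ^+ j * p ^+ 'C(j.+1, 2)) ^+ 2)).
  rewrite lerXn2r ?nnegrE ?mulr_ge0 ?exprn_ge0 ?ler0n ?(ltW p0) //.
  apply: le_trans (reg_clique reg) _.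
  by rewrite ler_piMr // mulr_ge0 ?exprn_ge0 ?ler0n // ltW.
rewrite !exprMn -!exprM [('C(_, _) * 2)%N]mulnC bin2_double.
by rewrite exprM expr2.
Qed.

Lemma bin_le_2pow m i : 'C(m, i)%:R <= 2 ^+ m :> R.
Proof.
rewrite -natrX ler_nat; elim: m i => [|m IH] [|i] //; first by rewrite bin0 expn_gt0.
by rewrite binS expnS mul2n -addnn leq_add.
Qed.

(* The cases [3 <= i] follow by comparing squares, the lower bound on [s] being
   of order [p ^ (- k / 2)]. *)
Lemma overlap_bound i : (2 <= i < j.+1)%N ->
  64 * (j.+1%:R * L * (j.+1 ^_ i)%:R * 'C(j.+1, i)%:R)
  <= s%:R ^+ i.-1 * p ^+ 'C(i, 2) * Qn.
Proof.
move=> /andP[i2 ij]; have /andP[q0 q1] := Qn01; have s0 := regime_s_gt0 reg.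
have k1 : 1 <= j.+1%:R :> R by rewrite ler1n.
have k0 : 0 <= j.+1%:R :> R by [].
case: i i2 ij => [|[|[|a]]] // _ ij.
  rewrite /= expr1 expr1; apply: le_trans (reg_edge reg).
  have c2 : 'C(j.+1, 2)%:R <= j.+1%:R ^+ 2 :> R.
    apply: le_trans (ffact_le_pow R _ _); rewrite -bin_ffact natrM.
    by rewrite ler_peMr ?ler0n // ler1n fact_gt0.
  have := ler_pM (ler0n _ _) (ler0n _ _) (ffact_le_pow R j.+1 2) c2.
  have kL : 0 <= 64 * (j.+1%:R * L) by rewrite !mulr_ge0 //; lra.
  move=> /(ler_wpM2l kL); have -> : j.+1%:R ^+ 2 * j.+1%:R ^+ 2 = j.+1%:R ^+ 4 :> R by ring.
  rewrite (_ : 64 * (j.+1%:R * L) * (_ * _) =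
    64 * (j.+1%:R * L * (j.+1 ^_ 2)%:R * 'C(j.+1, 2)%:R)); last by ring.
  move=> /le_trans; apply.
  have k5L : 0 <= j.+1%:R ^+ 5 * L by rewrite mulr_ge0 ?exprn_ge0 //; lra.
  rewrite (_ : _ * _ ^+ 4 = 64 * (j.+1%:R ^+ 5 * L)); last by ring.
  by rewrite -[leRHS]mulrA; move: (_ * L) k5L => x x0; lra.
set i := a.+3; rewrite -[i.-1]/(a.+2).
pose t := (j.+1 - a.+1.+3)%N.
have kE : j.+1 = (a.+1 + t + 3)%N by rewrite /t; lia.
set X := s%:R ^+ a.+2 * p ^+ 'C(i, 2).
have X0 : 0 <= X by rewrite mulr_ge0 ?exprn_ge0 // ltW.
pose B : R := 125 * 1000 * j.+1%:R ^+ 5 * L.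
have B0 : 0 <= B by rewrite !mulr_ge0 ?exprn_ge0 ?ler0n //; lra.
have XE : X ^+ 2 * p ^+ (a.+1 * t) = (s%:R * p) ^+ 2 * (s%:R ^+ 2 * p ^+ j.+1) ^+ a.+1.
  have -> : X ^+ 2 = s%:R ^+ (a.+2 * 2) * p ^+ (i * a.+2).
    rewrite /X [(_ * _) ^+ 2]exprMn -exprM -[p ^+ _ ^+ 2]exprM.
    by rewrite [('C(i, 2) * 2)%N]mulnC bin2_double.
  have -> : (s%:R * p) ^+ 2 * (s%:R ^+ 2 * p ^+ j.+1) ^+ a.+1 =
     s%:R ^+ (2 + 2 * a.+1) * p ^+ (2 + j.+1 * a.+1).
    rewrite [(s%:R * p) ^+ 2]exprMn [(_ * p ^+ j.+1) ^+ _]exprMn -[s%:R ^+ 2 ^+ _]exprM.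
    by rewrite -[p ^+ j.+1 ^+ _]exprM mulrACA -!exprD.
  rewrite -mulrA -exprD.
  congr (_ ^+ _ * _ ^+ _); first by lia.
  by rewrite kE /i; ring.
have X2 : 4 ^+ (a.+1 * t) * ((s%:R * p) ^+ 2 * (s%:R ^+ 2 * p ^+ j.+1) ^+ a.+1) <= X ^+ 2.
  rewrite -XE mulrCA -(exprMn (a.+1 * t) 4 p).
  rewrite ler_piMr ?exprn_ge0 // exprn_ile1 ?mulr_ge0 ?(ltW p0) //.
  by have := reg_p reg; have := p0; lra.
have XQ2 : 4 ^+ (a.+1 * t) * (B ^+ 2 * ((625 * 100 * j.+1%:R) ^+ 2) ^+ a.+1) <= (X * Qn) ^+ 2.
  rewrite [leRHS]exprMn; apply: le_trans (ler_wpM2r (exprn_ge0 2 (ltW q0)) X2).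
  rewrite -[leRHS]mulrA ler_wpM2l ?exprn_ge0 // [leRHS]mulrAC -(exprMn 2 (s%:R * p) Qn).
  apply: ler_pM; rewrite ?exprn_ge0 ?mulr_ge0 ?ler0n //.
    by rewrite lerXn2r ?nnegrE ?(reg_edge reg) // !mulr_ge0 ?ler0n ?(ltW p0) ?(ltW q0).
  by rewrite lerXn2r ?nnegrE ?clique_base ?mulr_ge0 ?exprn_ge0 ?mulr_ge0 ?ler0n ?(ltW p0).
pose Y : R := 64 * (j.+1%:R * L * j.+1%:R ^+ i * 2 ^+ j.+1).
have Y0 : 0 <= Y.
  apply: mulr_ge0 => //; apply: mulr_ge0; last exact: exprn_ge0.
  by apply: mulr_ge0; [apply: mulr_ge0 | apply: exprn_ge0].
apply: (@le_trans _ _ Y).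
  rewrite ler_wpM2l //; apply: ler_pM => //; last exact: bin_le_2pow.
    by rewrite !mulr_ge0.
  by rewrite ler_wpM2l ?mulr_ge0 ?ffact_le_pow.
have XQ0 : 0 <= X * Qn by rewrite mulr_ge0 // ltW.
rewrite -ler_sqr ?nnegrE //; apply: le_trans XQ2.
have k24 : j.+1%:R ^+ i = j.+1%:R ^+ 2 * j.+1%:R ^+ a.+1 :> R by rewrite -exprD.
have -> : Y ^+ 2 = 64 ^+ 2 * (j.+1%:R ^+ 6 * L ^+ 2 * (j.+1%:R ^+ 2) ^+ a.+1) * 4 ^+ j.+1.
  have -> : 4 = 2 ^+ 2 :> R by ring.
  by rewrite /Y k24 [_ ^+ 2 ^+ a.+1]exprAC [2 ^+ 2 ^+ _]exprAC; ring.
have -> : 4 ^+ (a.+1 * t) * (B ^+ 2 * ((625 * 100 * j.+1%:R) ^+ 2) ^+ a.+1) =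
  (125 * 1000) ^+ 2 * (j.+1%:R ^+ 10 * L ^+ 2 * (j.+1%:R ^+ 2) ^+ a.+1) *
  (4 ^+ (a.+1 * t) * ((625 * 100) ^+ 2) ^+ a.+1).
  rewrite /B [(625 * 100 * j.+1%:R) ^+ 2]exprMn.
  by rewrite (exprMn a.+1 ((625 * 100) ^+ 2)); ring.
have e1 : 4 ^+ j.+1 <= 64 * (4 ^+ (a.+1 * t) * ((625 * 100) ^+ 2) ^+ a.+1) :> R.
  rewrite kE exprD mulrC (_ : 4 ^+ 3 = 64 :> R); last by ring.
  have b4 : 4 <= (625 * 100) ^+ 2 :> R by lra.
  move: ((625 * 100) ^+ 2) b4 => b b4; have b0 : 0 <= b by lra.
  apply: ler_wpM2l; first by lra.
  apply: (@le_trans _ _ (4 ^+ (a.+1 * t) * 4 ^+ a.+1)).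
    rewrite -exprD; apply: ler_weXn2l; first by lra.
    by rewrite addnC leq_add2r leq_pmull.
  by apply: ler_wpM2l; [apply: exprn_ge0; lra | apply: lerXn2r => //; rewrite nnegrE; lra].
have e2 : j.+1%:R ^+ 6 * L ^+ 2 * (j.+1%:R ^+ 2) ^+ a.+1 <=
          j.+1%:R ^+ 10 * L ^+ 2 * (j.+1%:R ^+ 2) ^+ a.+1.
  by rewrite !ler_wpM2r ?exprn_ge0 // ler_weXn2l.
have e3 : 0 <= j.+1%:R ^+ 6 * L ^+ 2 * (j.+1%:R ^+ 2) ^+ a.+1.
  by apply: mulr_ge0; [apply: mulr_ge0|]; rewrite ?exprn_ge0.
apply: (@le_trans _ _ (64 ^+ 2 * (j.+1%:R ^+ 6 * L ^+ 2 * (j.+1%:R ^+ 2) ^+ a.+1) *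
   (64 * (4 ^+ (a.+1 * t) * ((625 * 100) ^+ 2) ^+ a.+1)))).
  by rewrite ler_wpM2l // mulr_ge0.
have e4 : 0 <= 4 ^+ (a.+1 * t) * ((625 * 100) ^+ 2) ^+ a.+1 :> R.
  by apply: mulr_ge0; apply: exprn_ge0; [|apply: exprn_ge0]; lra.
move: e2 e3 e4; move: (4 ^+ _ * _) (_ ^+ 6 * _ * _) (_ ^+ 10 * _ * _) => x y z yz y0' x0.
rewrite mulrA; apply: ler_wpM2r; first exact: x0.
lra.
Qed.

Lemma overlap_term i : (2 <= i < j.+1)%N ->
  ('C(j.+1, i) * 'C(s, j.+1 - i))%:R * p ^- 'C(i, 2) <=
  s%:R ^+ j.+1 * Qn / (64 * j.+1`!%:R * (s%:R * L) * j.+1%:R).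
Proof.
move=> ii; have /andP[i2 ij] := ii; have s0 := regime_s_gt0 reg.
have f0 : 0 < j.+1`!%:R :> R by rewrite ltr0n fact_gt0.
have d0 : 0 < 64 * j.+1`!%:R * (s%:R * L) * j.+1%:R.
  have Lp : 0 < L by have := L1; lra.
  by rewrite !mulr_gt0.
rewrite ler_pdivlMr // mulrAC ler_pdivrMr ?exprn_gt0 //.
have fE : j.+1`!%:R = (j.+1 ^_ i)%:R * (j.+1 - i)`!%:R :> R.
  by rewrite -natrM ffact_fact // ltnW.
have sE : s%:R ^+ j.+1 = s%:R ^+ i.-1 * (s%:R * s%:R ^+ (j.+1 - i)) :> R.
  by rewrite -exprS -exprD; congr (_ ^+ _); lia.
rewrite natrM fE sE.
have h1 := overlap_bound ii.
have h2 := bin_le_pow R s (j.+1 - i).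
have x0 : 0 <= 64 * (j.+1%:R * L * (j.+1 ^_ i)%:R * 'C(j.+1, i)%:R).
  by rewrite !mulr_ge0 ?ler0n //; lra.
have y0 : 0 <= 'C(s, j.+1 - i)%:R * (j.+1 - i)`!%:R :> R by rewrite mulr_ge0.
have := ler_pM x0 y0 h1 h2 => /(ler_wpM2l (ltW s0)).
set a := s%:R ^+ i.-1; set b := s%:R ^+ (_ - _).
move=> h; rewrite -subr_ge0 in h; rewrite -subr_ge0.
apply: le_trans h _; rewrite le_eqVlt; apply/orP; left; apply/eqP; ring.
Qed.

End CliqueRegime.

(** * The failure probability of a fixed set *)

Section PerSet.
Variables (R : realType) (T : finType) (j : nat) (p : R) (W : {set T}).
Let n := #|T|.
Let s := #|W|.
Hypothesis reg : regime n j s p.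
Let L : R := - ln p.
Let Q : R := 1 - p ^+ j.+1.
Let M : R := 'C(s, j.+1)%:R.
Implicit Types (E A : {set {set T}}) (K : {set T}).

Let p01 : 0 <= p <= 1. Proof. exact: regime_p01 reg. Qed.
Let p0 : 0 < p. Proof. exact: reg_p0 reg. Qed.
Let L1 : 1 <= L. Proof. exact: regime_L1 reg. Qed.
Let L0 : 0 <= L. Proof. by have := L1; lra. Qed.
Let Lp : 0 < L. Proof. by have := L1; lra. Qed.
Let s0 : 0 < s%:R :> R. Proof. exact: regime_s_gt0 reg. Qed.
Let M0 : 0 < M. Proof. exact: regime_M_gt0 reg. Qed.
Let Qn01 : 0 < Q ^+ n <= 1. Proof. exact: regime_Qn01 reg. Qed.

Let outside : seq T := enum (~: W).

Let outsideW : {in outside, forall v, v \notin W}.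
Proof. by move=> v; rewrite mem_enum inE. Qed.

Definition kfree E := uncovered W (ksubsets j.+1 W) outside E.

Definition capped E := low_deg W (8 * (n%:R * p)) outside E.

Lemma few_uncovered :
  Ex (edge_weight p) (fun E => (capped E)%:R * (#|kfree E|%:R <= M * Q ^+ n / 2)%R%:R)
  <= expR (- 3 * (s%:R * L)).
Proof.
have /andP[q0 q1] := Qn01.
set th := tilt_out n j s p.
set D := 64 * s%:R * p.
pose c : R := (D + p * s%:R) ^+ j / j`!%:R.
pose eta : R := s.+1%:R * expR (- (64 * s%:R * p)).
have tilt0 : 0 <= tilt j s p.
  by rewrite /tilt divr_ge0 ?ler0n // mulr_ge0 // mulr_ge0 ?ler0n.
have th0 : 0 <= th by rewrite divr_ge0 // ltW.
have c0 : 0 <= c.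
  by rewrite divr_ge0 ?ler0n // exprn_ge0 // addr_ge0 // !mulr_ge0 ?ler0n // ltW.
have thc : th * c <= 1 / 2 by exact: tilt_out_small reg.
have tE : th * Q ^+ n = tilt j s p by rewrite /th /tilt_out divfK // lt0r_neq0.
have tM : tilt j s p * M = 8 * (s%:R * L) by rewrite /tilt divfK ?mulrA // lt0r_neq0.
have exc := exceptional_mgf reg (erefl : #|W| = s).
have so : (size outside + size (@nil T) <= n)%N by rewrite addn0 -cardE max_card.
have uW : uniform j.+1 W (ksubsets j.+1 W) by apply/forall_inP => K; rewrite inE.
have uo : uniq (outside ++ [::]) by rewrite cats0 enum_uniq.
have oW : {in outside ++ [::], forall v, v \notin W} by rewrite cats0.
have main := uncovered_mgf p01 th0 c0 thc tilt0 (_ : _ <= th * Q ^+ n) exc uo oW so uW.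
apply: (@le_trans _ _ (expR (th * (M * Q ^+ n / 2)) * expR (n%:R * eta) * 
    expR (- (tilt j s p) * M + n%:R * (s%:R * (2 * p * (th * c) ^+ 2))))).
  apply: (@le_trans _ _ (Ex (edge_weight p) (fun E => expR (th * (M * Q ^+ n / 2)) *
     ((capped E)%:R * (1 * expR (- th * #|kfree E|%:R)))))).
    apply: le_Ex => [|E]; first exact: edge_weight01.
    rewrite mulrCA ler_wpM2l ?ler0n // mul1r -expRD.
    have [h|_] := leP (#|kfree E|%:R : R) (M * Q ^+ n / 2); last by rewrite expR_ge0.
    by rewrite -{1}expR0 ler_expR mulNr subr_ge0 ler_wpM2l.
  rewrite ExZ -[leRHS]mulrA ler_wpM2l ?expR_ge0 //.
  have {}main := main (_ : _ <= _); rewrite tE in main; have {}main := main (lexx _).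
  rewrite cats0 in main; apply: le_trans main _.
  rewrite cards_draws ler_wpM2r ?expR_ge0 //.
  apply: (@le_trans _ _ (expR eta ^+ size outside)).
    by rewrite lerXn2r ?nnegrE ?expR_ge0 ?expR_ge1Dx // addr_ge0 // mulr_ge0 ?expR_ge0.
  rewrite -expRM_natl ler_expR ler_wpM2r ?mulr_ge0 ?expR_ge0 //.
  by rewrite ler_nat; rewrite addn0 in so.
rewrite -!expRD ler_expR.
have h1 := exceptional_total reg; have h2 := typical_total reg.
have h3 : th * (M * Q ^+ n / 2) = tilt j s p * M / 2 by rewrite -tE; ring.
rewrite h3 mulNr tM; move: h1 h2; rewrite -/eta -/th.
move: (_ * eta) (_ * (_ * (_ * _ ^+ 2))) => x y; rewrite -/L; lra.
Qed.

Definition clique_in E K := ksubsets 2 K \subset E.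

Lemma card_overlap A K i : uniform j.+1 W A -> K \subset W -> #|K| = j.+1 ->
  (#|[set K' in A | #|K :&: K'| == i]| <= 'C(j.+1, i) * 'C(s, j.+1 - i))%N.
Proof.
move=> uA KW cK; pose f K' := (K :&: K', K' :\: K).
have finj : injective f.
  by move=> K1 K2 [e1 e2]; rewrite -(setID K1 K) -(setID K2 K) ![_ :&: K]setIC e1 e2.
rewrite -(card_imset _ finj) -{1}cK -!cards_draws -cardsX.
apply: subset_leq_card; apply/subsetP => _ /imsetP[K' + ->].
rewrite !inE => /andP[/(uniformP uA)[KW' cK'] /eqP ci].
rewrite subsetIl ci eqxx /= (subset_trans (subsetDl _ _) KW') /=.
by rewrite -cK' -(cardsID K K') setIC ci addKn.
Qed.

Let P : R := p ^+ 'C(j.+1, 2).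
Let wt K := \prod_(e in ksubsets 2 K) edge_weight p e.

Let wtE K : wt K = p ^+ 'C(#|K|, 2).
Proof.
rewrite -cards_draws -prodr_const; apply: eq_bigr => e.
by rewrite inE /edge_weight => /andP[_ ->].
Qed.

Let wtU K K' : #|K| = j.+1 -> #|K'| = j.+1 ->
  \prod_(e in ksubsets 2 K :|: ksubsets 2 K') edge_weight p e =
  P ^+ 2 * p ^- 'C(#|K :&: K'|, 2).
Proof.
move=> cK cK'.
have -> : \prod_(e in ksubsets 2 K :|: ksubsets 2 K') edge_weight p e =
    p ^+ #|ksubsets 2 K :|: ksubsets 2 K'|.
  rewrite -prodr_const; apply: eq_bigr => e.
  by rewrite !inE /edge_weight -andb_orl => /andP[_ ->].
have e : (#|ksubsets 2 K :|: ksubsets 2 K'| + 'C(#|K :&: K'|, 2) = 'C(j.+1, 2) + 'C(j.+1, 2))%N.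
  have -> : 'C(#|K :&: K'|, 2) = #|ksubsets 2 K :&: ksubsets 2 K'|.
    rewrite -cards_draws; apply: eq_card => e; rewrite !inE subsetI.
    by case: (_ == _); rewrite ?andbT ?andbF.
  by rewrite cardsUI !cards_draws cK cK'.
have pC : p ^+ 'C(#|K :&: K'|, 2) != 0 by rewrite expf_neq0 // lt0r_neq0.
by apply: (mulIf pC); rewrite divfK // -exprD e addnn -muln2 exprM.
Qed.

Let wt_nbr A K : uniform j.+1 W A -> K \in A ->
  \sum_(K' in A | (K' != K) && ~~ [disjoint ksubsets 2 K & ksubsets 2 K'])
     \prod_(e in ksubsets 2 K :|: ksubsets 2 K') edge_weight p e
  <= P ^+ 2 * (s%:R ^+ j.+1 * Q ^+ n / (64 * j.+1`!%:R * (s%:R * L))).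
Proof.
move=> uA KA; have [KW cK] := uniformP uA KA.
have P2 : 0 <= P ^+ 2 by rewrite sqr_ge0.
have k0 : 0 < j.+1%:R :> R by [].
pose x i : R := p ^- 'C(i, 2).
have x0 i : 0 <= x i by rewrite invr_ge0 exprn_ge0 // ltW.
apply: (@le_trans _ _ (\sum_(K' in A) \sum_(i < j.+1 | (2 <= i)%N)
    (#|K :&: K'| == i)%:R * (P ^+ 2 * x i))).
  rewrite big_mkcondr; apply: ler_sum => K' K'A.
  have [KW' cK'] := uniformP uA K'A.
  case: ifP => [/andP[neq ndis]|_]; last first.
    by apply: sumr_ge0 => i _; rewrite mulr_ge0 ?ler0n // mulr_ge0.
  have i1 : (2 <= #|K :&: K'|)%N.
    rewrite leqNgt; apply: contra ndis => small; rewrite -setI_eq0 -subset0.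
    apply/subsetP => e; rewrite !inE => /andP[/andP[eK /eqP ce] /andP[eK' _]].
    have : (#|e| <= #|K :&: K'|)%N by rewrite subset_leq_card // subsetI eK.
    by rewrite ce leqNgt small.
  have i2 : (#|K :&: K'| < j.+1)%N.
    rewrite ltn_neqAle -{2}cK subset_leq_card ?subsetIl // andbT.
    apply: contra neq => /eqP ci.
    have /eqP KI : K :&: K' == K by rewrite eqEcard subsetIl /= ci cK.
    by rewrite eq_sym eqEcard cK cK' leqnn andbT -{1}KI subsetIr.
  rewrite (bigD1 (Ordinal i2)) //= eqxx mul1r wtU // lerDl.
  by apply: sumr_ge0 => i _; rewrite mulr_ge0 ?ler0n // mulr_ge0.
rewrite exchange_big /=.
apply: (@le_trans _ _ (\sum_(i < j.+1 | (2 <= i)%N) P ^+ 2 *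
   (s%:R ^+ j.+1 * Q ^+ n / (64 * j.+1`!%:R * (s%:R * L) * j.+1%:R)))).
  apply: ler_sum => i i2; rewrite -mulr_suml mulrCA ler_wpM2l //.
  apply: le_trans (overlap_term reg (i := i) _); last by rewrite i2 ltn_ord.
  rewrite ler_wpM2r // -natr_sum ler_nat.
  apply: leq_trans (card_overlap i uA KW cK).
  rewrite -sum1_card [leqRHS](eq_bigl (fun K' => (K' \in A) && (#|K :&: K'| == i))).
    by rewrite big_mkcondr; apply: leq_sum => K' _; case: eqP.
  by move=> K'; rewrite inE.
set y := P ^+ 2 * (_ / (_ * _)).
have y0 : 0 <= y.
  have /andP[/ltW Qn0 _] := Qn01.
  apply: mulr_ge0 => //; apply: divr_ge0; first by apply: mulr_ge0; [exact: exprn_ge0 | exact: Qn0].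
  by rewrite !mulr_ge0 ?ler0n.
apply: (@le_trans _ _ (\sum_(i < j.+1) y)).
  by rewrite big_mkcond; apply: ler_sum => i _; case: ifP.
rewrite sumr_const card_ord -[leLHS]mulr_natr /y.
by rewrite [(_ * j.+1%:R)^-1]invfM !mulrA divfK // lt0r_neq0.
Qed.

Lemma no_clique (A : {set {set T}}) : uniform j.+1 W A -> M * Q ^+ n / 2 <= #|A|%:R ->
  Ex (edge_weight p) (fun E => \prod_(K in A) (1 - (clique_in E K)%:R))
  <= expR (- 3 * (s%:R * L)).
Proof.
move=> uA bigA; have /andP[q0 q1] := Qn01.
have P0 : 0 < P by rewrite exprn_gt0.
have f0 : 0 < j.+1`!%:R :> R by rewrite ltr0n fact_gt0.
have sL : 0 < s%:R * L by rewrite mulr_gt0 //; have := L1; lra.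
pose a : R := #|A|%:R; pose mu := a * P.
have a_ge : s%:R ^+ j.+1 * Q ^+ n / (4 * j.+1`!%:R) <= a.
  apply: le_trans bigA; rewrite ler_pdivrMr ?mulr_gt0 //.
  have := ler_wpM2r (ltW q0) (regime_M reg); rewrite -/M; lra.
have mu_ge : 4 * (s%:R * L) <= mu.
  apply: le_trans (ler_wpM2r (ltW P0) a_ge).
  rewrite mulrAC ler_pdivlMr ?mulr_gt0 // exprS.
  have := ler_wpM2l (ltW s0) (reg_clique reg).
  have k2 : 16 <= 1000 ^+ 2 ^+ j * j.+1%:R :> R.
    have a1 : 1000 ^+ 2 <= (1000 ^+ 2) ^+ j :> R.
      by rewrite -[leLHS]expr1 ler_weXn2l ?(reg_j reg) //; lra.
    have a2 : 1 <= j.+1%:R :> R by rewrite ler1n.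
    nra.
  have fL : 0 <= s%:R * (j.+1`!%:R * L) by rewrite !mulr_ge0.
  have := ler_wpM2r fL k2; rewrite -/P -/L -/Q; lra.
have mu0 : 0 < mu by apply: lt_le_trans mu_ge; rewrite mulr_gt0.
pose q := 4 * (s%:R * L) / mu.
have q01 : 0 <= q <= 1.
  by rewrite /q ler_pdivrMr // mul1r mu_ge andbT divr_ge0 // ltW // mulr_gt0.
apply: (@le_trans _ _ (Ex (edge_weight p) (fun E =>
    \prod_(K <- enum A) (1 - q * (ksubsets 2 K \subset E)%:R)))).
  apply: le_Ex => [|E]; first exact: edge_weight01.
  rewrite big_enum /=; apply: ler_prod => K _; rewrite /clique_in.
  by case: (_ \subset E);
    rewrite ?mulr1 ?mulr0 ?subrr ?subr0 ?lexx ?ler01 ?subr_ge0 /= ?(andP q01).2.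
apply: le_trans (janson (edge_weight01 p01) _ q01 (enum_uniq A)) _.
rewrite ler_expR !big_enum /=.
have -> : \sum_(K in A) \prod_(e in ksubsets 2 K) edge_weight p e = mu.
  rewrite (eq_bigr (fun=> P)) ?sumr_const -?[LHS]mulr_natl // => K /(uniformP uA)[_ cK].
  by have := wtE K; rewrite cK.
set X := \sum_(K in A) _.
have Xle : X <= mu ^+ 2 / (16 * (s%:R * L)).
  apply: (@le_trans _ _ (\sum_(K in A) P ^+ 2 *
      (s%:R ^+ j.+1 * Q ^+ n / (64 * j.+1`!%:R * (s%:R * L))))).
    apply: ler_sum => K KA; rewrite big_enum_cond; exact: wt_nbr.
  rewrite sumr_const -[leLHS]mulr_natl -/a.
  rewrite ler_pdivlMr ?mulr_gt0 //.
  have := ler_wpM2l (mulr_ge0 (ler0n R #|A|) (sqr_ge0 P)) a_ge.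
  rewrite -/a /mu => h; apply: (@le_trans _ _ (a * P ^+ 2 * a)); last first.
    by rewrite le_eqVlt; apply/orP; left; apply/eqP; ring.
  apply: le_trans h; rewrite le_eqVlt; apply/orP; left; apply/eqP; field.
  by rewrite !lt0r_neq0 //; have := L1; lra.
have q20 : 0 <= q ^+ 2 by rewrite sqr_ge0.
have := ler_wpM2l q20 Xle.
have -> : q ^+ 2 * (mu ^+ 2 / (16 * (s%:R * L))) = s%:R * L.
  by rewrite /q; field; rewrite !lt0r_neq0 //; have := L1; lra.
have -> : - q * mu = - (4 * (s%:R * L)) by rewrite /q mulNr divfK // lt0r_neq0.
lra.
Qed.

Definition all_covered E := [forall K in kfree E, ~~ clique_in E K].

Lemma all_covered_rare :
  Ex (edge_weight p) (fun E => (capped E && all_covered E)%:R)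
  <= 2 * expR (- 3 * (s%:R * L)).
Proof.
pose x := M * Q ^+ n / 2.
apply: (@le_trans _ _ (Ex (edge_weight p) (fun E =>
   (capped E)%:R * (#|kfree E|%:R <= x)%R%:R +
   (x < #|kfree E|%:R)%R%:R * \prod_(K in kfree E) (1 - (clique_in E K)%:R)))).
  apply: le_Ex => [|E]; first exact: edge_weight01.
  case: (capped E) => /=; last first.
    rewrite mul0r add0r mulr_ge0 ?ler0n // prodr_ge0 // => K _.
    by rewrite subr_ge0 lern1 leq_b1.
  rewrite mul1r; have [_|_] /= := leP (#|kfree E|%:R : R) x.
    by rewrite mul0r addr0 lern1 leq_b1.
  rewrite add0r mul1r; case: (boolP (all_covered E)) => [/forall_inP ac|_].
    by rewrite big1 // => K /ac /negPf ->; rewrite subr0.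
  by rewrite prodr_ge0 // => K _; rewrite subr_ge0 lern1 leq_b1.
rewrite ExD (_ : 2 * _ = expR (- 3 * (s%:R * L)) + expR (- 3 * (s%:R * L))); last by ring.
rewrite lerD ?few_uncovered // (Ex_resample _ (ksubsets 2 W)) ExC.
apply: Ex_le_cst => [|E2]; first exact: edge_weight01.
have kE E1 : kfree (E1 :&: ksubsets 2 W :|: E2 :\: ksubsets 2 W) = kfree E2.
  apply/setP => K; rewrite !inE; congr (_ && _); apply: eq_in_all => v vo.
  suff -> : nb W (E1 :&: ksubsets 2 W :|: E2 :\: ksubsets 2 W) v = nb W E2 v by [].
  apply/setP => w; rewrite !inE; congr (_ && _).
  have -> : ([set v; w] \subset W) = false.
    by apply/negP => /subsetP/(_ v); rewrite !inE eqxx (negPf (outsideW vo)) => /(_ isT).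
  by rewrite andbF.
rewrite (eq_Ex _ (g := fun E1 => (x < #|kfree E2|%:R)%R%:R *
    \prod_(K in kfree E2) (1 - (clique_in E1 K)%:R))); last first.
  move=> E1; rewrite kE; congr (_ * _); apply: eq_bigr => K.
  rewrite !inE => /andP[/andP[KW _] _]; congr (1 - _%:R); congr nat_of_bool.
  apply/subsetP/subsetP => h e eK; have := h e eK; rewrite !inE.
    have : e \subset W by move: eK; rewrite inE => /andP[/subset_trans/(_ KW)].
    by move: eK; rewrite inE => /andP[_ ->] ->; rewrite /= orbF andbT.
  by move: eK; rewrite inE => /andP[/subset_trans/(_ KW) -> ->] ->.
rewrite ExZ; have [_|bigA] := leP (#|kfree E2|%:R : R) x; first by rewrite mul0r expR_ge0.
rewrite mul1r; apply: no_clique; last exact: ltW.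
by apply/forall_inP => K; rewrite !inE => /andP[].
Qed.

End PerSet.

(** * Union bound over colour classes *)

Section GraphLink.
Variables (T : finType) (G : sgraph T).

Lemma clique_ksubsets (K : {set T}) : ksubsets 2 K \subset edges G -> clique G K.
Proof.
move=> /subsetP KE; apply/forall_inP => x xK; apply/forall_inP => y yK.
apply/implyP => xy; apply: KE; rewrite inE cards2 xy andbT.
by apply/subsetP => z; rewrite !inE => /orP[] /eqP ->.
Qed.

Lemma colour_class_covered (q j : nat) (f : {ffun T -> 'I_q}) (W : {set T}) :
  (0 < j)%N -> clique_coloring G f -> {in W &, forall x y, f x = f y} ->
  all_covered j W (edges G).
Proof.
move=> j0 /forallP fG fW; apply/forall_inP => K; rewrite !inE.
move=> /andP[/andP[KW /eqP cK] /allP unc]; apply/negP => /clique_ksubsets clK.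
have [K' mK' KK'] := maxset_exists clK.
have K'2 : (1 < #|K'|)%N.
  by apply: leq_trans (subset_leq_card KK'); rewrite cK.
have := fG K'; rewrite /maximal_clique mK' K'2 /= => /negP; apply.
have K'W : K' \subset W.
  apply/subsetP => v vK'; apply: contraT => vW.
  have /negP[] : ~~ (K \subset nb W (edges G) v) by apply: unc; rewrite mem_enum inE.
  apply/subsetP => w wK; rewrite inE (subsetP KW) //=.
  have /forall_inP/(_ v vK')/forall_inP/(_ w (subsetP KK' w wK))/implyP := maxsetp mK'.
  by apply; apply: contraNneq vW => ->; apply: (subsetP KW).
apply/forall_inP => x xK; apply/forall_inP => y yK.
by rewrite (fW x y) ?(subsetP K'W).
Qed.

Lemma large_colour_class (q s : nat) (f : {ffun T -> 'I_q}) : (q * s.-1 < #|T|)%N ->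
  exists2 W : {set T}, #|W| = s & {in W &, forall x y, f x = f y}.
Proof.
move=> qs; have [c hc] : exists c, (s <= #|[set x | f x == c]|)%N.
  apply/existsP; apply: contraLR qs; rewrite negb_exists => /forallP h.
  rewrite -leqNgt -sum1_card (partition_big f xpredT) //=.
  rewrite -[X in (_ <= X * _)%N](card_ord q) -sum_nat_const; apply: leq_sum => c _.
  have := h c; rewrite -ltnNge => hs; rewrite sum1dep_card.
  by case: (s) hs.
have : (0 < #|[set W : {set T} | W \subset [set x | f x == c] & #|W| == s]|)%N.
  by rewrite cards_draws bin_gt0.
rewrite card_gt0 => /set0Pn[W]; rewrite inE => /andP[/subsetP Wc /eqP cW].
by exists W => // x y /Wc + /Wc; rewrite !inE => /eqP -> /eqP ->.
Qed.

End GraphLink.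

Lemma gnp_prob_le_Ex (R : realType) (n : nat) (p : R) (A : pred (sgraph 'I_n))
    (b : {set {set 'I_n}} -> bool) : 0 <= p <= 1 ->
  (forall G, A G -> b (edges G)) ->
  gnp_prob p A <= Ex (edge_weight p) (fun E => (b E)%:R).
Proof.
move=> p01 Ab; pose F E := bern (edge_weight p) E * (b E)%:R.
have F0 E : 0 <= F E by rewrite mulr_ge0 ?ler0n // bern_ge0 //; apply: edge_weight01.
rewrite /gnp_prob (eq_bigr (fun G => F (edges G))); last first.
  move=> G /Ab bG; rewrite /F bG mulr1 /bern /gnp_mass big_mkcond /=.
  apply: eq_bigr => e _; rewrite /edge_weight; case: ifP => // e2.
  case: ifP; last by rewrite subr0.
  by move=> /(subsetP (edgesP G)); rewrite inE e2.
pose pairs : {set {set 'I_n}} := [set e : {set 'I_n} | #|e| == 2%N].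
have re : \sum_(E : {set {set 'I_n}} | E \subset pairs) F E = \sum_(G : sgraph 'I_n) F (edges G).
  rewrite (reindex_omap (@edges 'I_n) insub) /=.
    by apply: eq_bigl => G; rewrite edgesP valK eqxx.
  by move=> E sE; rewrite insubT.
apply: (@le_trans _ _ (\sum_(G : sgraph 'I_n) F (edges G))).
  by rewrite [leRHS](bigID A) /= lerDl; apply: sumr_ge0 => G _; apply: F0.
rewrite -re /Ex [leRHS](bigID (fun E : {set {set 'I_n}} => E \subset pairs)) /= lerDl.
by apply: sumr_ge0 => E _; apply: F0.
Qed.

Section UnionBound.
Variables (R : realType) (T : finType) (j s : nat) (p : R).
Let n := #|T|.
Hypothesis reg : regime n j s p.
Let L : R := - ln p.
Let p01 : 0 <= p <= 1. Proof. exact: regime_p01 reg. Qed.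
Let p0 : 0 < p. Proof. exact: reg_p0 reg. Qed.
Let L1 : 1 <= L. Proof. exact: regime_L1 reg. Qed.
Let s0 : 0 < s%:R :> R. Proof. exact: regime_s_gt0 reg. Qed.
Let np1 : 1 <= n%:R * p. Proof. exact: reg_np reg. Qed.

Lemma large_degree_rare (v : T) :
  Ex (edge_weight p) (fun E => (8 * (n%:R * p) < #|nb (~: [set v]) E v|%:R)%R%:R)
  <= expR (- (4 * (n%:R * p))).
Proof.
set x := 8 * (n%:R * p); have x0 : 0 <= x by have := np1; rewrite /x; lra.
pose d := (Num.truncn x).+1.
have xd : x < d%:R by apply: truncnS_gt.
have vv : v \notin ~: [set v] by rewrite !inE eqxx.
rewrite (Ex_nb p (fun N => (x < #|N|%:R)%R%:R) vv).
apply: (@le_trans _ _ (Ex (fun=> p) (fun N => (d <= #|N :&: ~: [set v]|)%N%:R))).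
  apply: le_Ex => [_ //|N]; rewrite ler_nat.
  by rewrite -(truncn_lt_nat _ x0).
apply: le_trans (Ex_card_ge _ _ _ (x := p) _) _ => //.
set m := #|~: [set v]|; have mn : m%:R <= n%:R :> R by rewrite ler_nat max_card.
have d0 : 0 < d%:R :> R by [].
apply: (@le_trans _ _ ((expR 1 * (m%:R / d%:R)) ^+ d * p ^+ d)).
  by rewrite ler_wpM2r ?exprn_ge0 ?(ltW p0) // bin_le_expR.
have e4 := expR1_le4 R; have eE : expR 1 = expR (1 / 2) ^+ 2 :> R.
  by rewrite -expRM_natl; congr expR; lra.
have h0 := expR_gt0 (1 / 2 : R).
have h2 : expR (1 / 2) <= 2 :> R.
  rewrite leNgt; apply/negP => h; have : 4 < expR 1 :> R by rewrite eE; nra.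
  by lra.
rewrite -exprMn; apply: (@le_trans _ _ (expR (- (1 / 2)) ^+ d)).
  rewrite lerXn2r ?nnegrE ?expR_ge0 ?mulr_ge0 ?expR_ge0 ?invr_ge0 ?ler0n ?(ltW p0) //.
  rewrite expRN; apply: (@le_trans _ _ (expR 1 / 8)).
    rewrite -!mulrA ler_wpM2l ?expR_ge0 // mulrA mulrAC ler_pdivrMr //.
    have : m%:R * p <= n%:R * p by rewrite ler_wpM2r // ltW.
    move: xd; rewrite /x; lra.
  rewrite ler_pdivrMr // ler_pdivlMl // eE.
  have : expR (1 / 2) ^+ 3 <= 2 ^+ 3 :> R by rewrite lerXn2r ?nnegrE ?expR_ge0.
  lra.
rewrite -expRM_natl ler_expR; move: xd; rewrite /x; lra.
Qed.

Lemma choose_le_expR : 'C(n, s)%:R <= expR (s%:R * L).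
Proof.
have s1 : (0 < s)%N by rewrite -(ltr0n R).
apply: le_trans (bin_le_expR R n s1) _.
rewrite expRM_natl lerXn2r ?nnegrE ?expR_ge0 ?mulr_ge0 ?expR_ge0 ?invr_ge0 ?ler0n //.
rewrite -[expR L]invrK -expRN (regime_expL reg).
rewrite -[leRHS]mul1r ler_pdivlMr // -mulrA mulrAC mulrA ler_pdivrMr // mul1r.
have h := reg_s reg; have e4 := expR1_le4 R; have e0 := expR_ge0 (1 : R).
by apply: le_trans h; apply: ler_wpM2r; [have := np1; lra | lra].
Qed.

Lemma covered_set_rare :
  Ex (edge_weight p) (fun E => [exists W : {set T}, (#|W| == s) && all_covered j W E]%:R)
  <= (n%:R + 2) * expR (- (4 * (n%:R * p))).
Proof.
apply: (@le_trans _ _ (Ex (edge_weight p) (fun E =>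
   \sum_v (8 * (n%:R * p) < #|nb (~: [set v]) E v|%:R)%R%:R +
   \sum_(W : {set T} | #|W| == s) (capped p W E && all_covered j W E)%:R))).
  apply: le_Ex => [|E]; first exact: edge_weight01.
  have S1 : 0 <= \sum_v (8 * (n%:R * p) < #|nb (~: [set v]) E v|%:R)%R%:R :> R.
    by apply: sumr_ge0 => v _; apply: ler0n.
  have S2 : 0 <= \sum_(W : {set T} | #|W| == s) (capped p W E && all_covered j W E)%:R :> R.
    by apply: sumr_ge0 => v _; apply: ler0n.
  case: existsP => [[W /andP[cW ac]]|_]; last by rewrite addr_ge0.
  have [cap|ncap] := boolP (capped p W E).
    rewrite ler_wpDl // (bigD1 W) //= cap ac lerDl.
    by apply: sumr_ge0 => v _; apply: ler0n.
  have /allPn[v vo] := ncap; rewrite -ltNge => big.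
  rewrite ler_wpDr // (bigD1 v) //= (lt_le_trans big).
    by rewrite lerDl; apply: sumr_ge0 => ? _; apply: ler0n.
  rewrite ler_nat subset_leq_card //; apply/subsetP => w; rewrite !inE => /andP[wW ->].
  rewrite andbT; apply: contraTneq wW => ->.
  by move: vo; rewrite mem_enum inE.
rewrite ExD !Ex_sum [leRHS]mulrDl; apply: lerD.
  apply: (@le_trans _ _ (\sum_(v : T) expR (- (4 * (n%:R * p))))).
    by apply: ler_sum => v _; apply: large_degree_rare.
  by rewrite sumr_const [leRHS]mulr_natl.
apply: (@le_trans _ _ (\sum_(W : {set T} | #|W| == s) 2 * expR (- 3 * (s%:R * L)))).
  apply: ler_sum => W /eqP cW; rewrite /L -cW; apply: all_covered_rare.
  by rewrite cW.
rewrite sumr_const -[leLHS]mulr_natl -[#|_|]/(#|fun W : {set T} => #|W| == s|).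
have -> : #|fun W : {set T} => #|W| == s| = 'C(n, s).
  rewrite -(card_draws T s); apply: eq_card => W.
  by rewrite !inE.
apply: le_trans (ler_wpM2r _ choose_le_expR) _; first by rewrite mulr_ge0 ?expR_ge0.
rewrite mulrCA -expRD ler_wpM2l // ler_expR.
have h := reg_s reg.
have : s%:R <= s%:R * L by rewrite ler_peMr // ltW.
have := np1; lra.
Qed.

End UnionBound.

Section Hypotheses.
Variables (R : realType) (C : R) (n j : nat) (p : R).
Let k := j.+1.
Let L : R := ln (1 / p).
Let z : R := (1 - p ^+ k) `^ (n%:R / (k%:R - 1)).

Definition chromatic_bound : R :=
  1 / C ^+ 2 * Num.min (1 / p)
    (p `^ (k%:R / 2) * n%:R / (k`!%:R * k%:R * L) `^ (1 / (k%:R - 1))) * z.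

Hypotheses (CE : C = 1000) (j0 : (0 < j)%N) (p01 : 0 <= p <= 1) (np1 : 1 <= n%:R * p)
  (Lnp : L <= n%:R * p).
Hypothesis p_le : p <= (6 * C)^-1
   * (k%:R ^+ 2 * L * (n%:R * p)) `^ (- (1 / (2 * (k%:R - 1)))) * z.
Hypothesis edge_le : (3 <= k)%N%:R * k%:R ^+ 5 * L
   <= Num.max (n%:R * p ^+ 2) (p `^ (- ((k%:R - 2) / 2)))
      * (1 - p ^+ k) `^ (n%:R * (k%:R - 2) / (k%:R - 1)).

Let C0 : 0 < C. Proof. by rewrite CE ltr0n. Qed.

Let jE : k%:R - 1 = j%:R :> R.
Proof. by rewrite /k -natr1 addrK. Qed.

Let jR0 : j%:R != 0 :> R. Proof. by rewrite pnatr_eq0 -lt0n. Qed.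

Let p0 : 0 < p.
Proof.
have /andP[p0 _] := p01; rewrite lt_neqAle p0 andbT; apply: contraTneq np1 => <-.
by rewrite mulr0 ler10.
Qed.

Let p_lt1 : p < 1.
Proof.
have /andP[_ p1] := p01; rewrite lt_neqAle p1 andbT.
apply/eqP => pE; have := p_le; rewrite /L pE divr1 ln1 mulr0 mul0r powR0.
  by rewrite mulr0 mul0r ler10.
by rewrite oppr_eq0 jE mul1r invr_eq0 mulf_neq0.
Qed.

Let LE : L = - ln p.
Proof. by rewrite /L mul1r lnV ?posrE. Qed.

Let L_gt0 : 0 < L.
Proof. by rewrite LE oppr_gt0 ln_lt0 // p0. Qed.

Let n0 : 0 < n%:R :> R.
Proof.
rewrite lt_neqAle ler0n andbT; apply: contraTneq np1 => <-.
by rewrite mul0r ler10.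
Qed.

Let Q01 : 0 < 1 - p ^+ k < 1.
Proof.
have h := exprn_gt0 k p0; have : p ^+ k < 1 by rewrite exprn_ilt1 // ltW.
by move=> h'; apply/andP; split; lra.
Qed.

Let z_gt0 : 0 < z.
Proof. by rewrite powR_gt0 // (andP Q01).1. Qed.

Let zj : z ^+ j = (1 - p ^+ k) ^+ n.
Proof.
have /andP[q0 _] := Q01.
by rewrite -powR_mulrn ?powR_ge0 // -powRrM jE divfK // powR_mulrn // ltW.
Qed.

Let z_le1 : z <= 1.
Proof.
have /andP[q0 q1] := Q01.
by rewrite -(@expr_le1 _ j) // ?(ltW z_gt0) // zj exprn_ile1 ?ltW.
Qed.

Let fluct : (6 * C * p) ^+ (2 * j) * (k%:R ^+ 2 * L * (n%:R * p)) <= ((1 - p ^+ k) ^+ n) ^+ 2.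
Proof.
set y := k%:R ^+ 2 * L * (n%:R * p).
have y0 : 0 < y.
  by rewrite !mulr_gt0 ?exprn_gt0.
have y0' : 0 <= y `^ (- (1 / (2 * j%:R))) by apply: powR_ge0.
have h : 6 * C * p <= y `^ (- (1 / (2 * j%:R))) * z.
  move: p_le; rewrite jE -/y -mulrA => h.
  by move: h; rewrite ler_pdivlMl // mulr_gt0.
have p60 : 0 <= 6 * C * p by rewrite !mulr_ge0 ?ltW.
have yE : (y `^ (- (1 / (2 * j%:R)))) ^+ (2 * j) = y^-1.
  rewrite -powR_mulrn // -powRrM natrM mulNr mul1r mulVf ?mulf_neq0 //.
  by rewrite powR_inv1 // ltW.
have := lerXn2r (2 * j) p60 (mulr_ge0 y0' (ltW z_gt0)) h.
rewrite [leRHS]exprMn yE [z ^+ (2 * j)]exprM exprAC zj.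
by rewrite [y^-1 * _]mulrC ler_pdivlMr.
Qed.

Let bernoulli_le m : 1 - p ^+ m <= m%:R * (1 - p).
Proof.
elim: m => [|m IH]; first by rewrite expr0 subrr mul0r.
have /andP[_ p1] := p01.
have h : p ^+ m <= 1 by rewrite exprn_ile1 // ltW.
have h0 : 0 <= p ^+ m by rewrite exprn_ge0 // ltW.
by rewrite exprS -natr1; nra.
Qed.

Let p_small : 6 * C * p < 1.
Proof.
rewrite ltNge; apply/negP => big; have /andP[q0 q1] := Q01.
have h1 : 1 <= (6 * C * p) ^+ (2 * j) by rewrite exprn_ege1.
clear big.
have y0 : 0 < k%:R ^+ 2 * L * (n%:R * p) by rewrite !mulr_gt0 ?exprn_gt0.
have := le_trans (ler_peMl (ltW y0) h1) fluct.
have n1 : (0 < n)%N by rewrite -(ltr0n R).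
have Qn : ((1 - p ^+ k) ^+ n) ^+ 2 <= 1 - p ^+ k.
  rewrite -exprM -[leRHS]expr1 ler_wiXn2l ?ltW //.
  by rewrite muln_gt0 n1.
move=> /le_trans/(_ Qn)/le_trans/(_ (bernoulli_le k)).
have L1p : 1 - p <= L.
  have := le_ln1Dx (x := p - 1); rewrite addrCA subrr addr0 => h.
  by rewrite LE; have := h (_ : -1 < p - 1); have := p0; lra.
have k2 : 2 <= k%:R :> R by rewrite ler_nat.
have k0 : 0 < k%:R :> R by lra.
have h2 := ler_wpM2l (ltW k0) L1p.
move=> /le_trans/(_ h2); apply/negP; rewrite -ltNge.
rewrite expr2 -!mulrA ltr_pM2l // mulrCA -[ltLHS]mulr1 ltr_pM2l //.
by have := np1; nra.
Qed.

Let L1 : 1 <= L.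
Proof.
rewrite LE -(ler_expR 1) expRN lnK ?posrE //.
apply: le_trans (expR1_le4 _) _; rewrite -[leRHS]mul1r ler_pdivlMr //.
by move: p_small; rewrite CE; have := p0; lra.
Qed.

Let w : R := (k`!%:R * k%:R * L) `^ (1 / j%:R).

Let fkL : 1 <= k`!%:R * k%:R * L.
Proof.
have f1 : 1 <= k`!%:R :> R by rewrite ler1n fact_gt0.
by rewrite mulr_ege1 // mulr_ege1 // ler1n.
Qed.

Let w1 : 1 <= w.
Proof. by rewrite -(powRr0 (k`!%:R * k%:R * L)) /w ler_powR // divr_ge0 ?ler0n. Qed.

Let wj : w ^+ j = k`!%:R * k%:R * L.
Proof.
have h : 0 <= k`!%:R * k%:R * L by apply: le_trans fkL.
by rewrite -powR_mulrn ?powR_ge0 // -powRrM mul1r mulVf // powRr1.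
Qed.

Lemma chromatic_bound_gt0 : 0 < chromatic_bound.
Proof.
apply: mulr_gt0 => //; apply: mulr_gt0; first by rewrite divr_gt0 ?exprn_gt0.
rewrite lt_min divr_gt0 //=.
by rewrite divr_gt0 ?mulr_gt0 ?powR_gt0 // (lt_le_trans ltr01 fkL).
Qed.

Lemma regime_of_hypotheses s : (s <= n)%N -> n%:R <= s%:R * chromatic_bound ->
  regime n j s p.
Proof.
move=> sn nsB; have s0 : 0 <= s%:R :> R by [].
have z0 := z_gt0; have z1 := z_le1.
have ph0 : 0 < p `^ (k%:R / 2) by rewrite powR_gt0.
have w0 : 0 < w by apply: lt_le_trans w1.
have C20 : 0 < C ^+ 2 by rewrite exprn_gt0.
have cE (x : R) : chromatic_bound <= 1 / C ^+ 2 * x * z -> 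
    C ^+ 2 * n%:R <= s%:R * (x * z).
  move=> h; have := le_trans nsB (ler_wpM2l s0 h).
  move=> /(ler_wpM2l (ltW C20)) /le_trans; apply.
  rewrite le_eqVlt; apply/orP; left; apply/eqP; field.
  by rewrite lt0r_neq0.
have E1 : C ^+ 2 * (n%:R * p) <= s%:R * z.
  have h : C ^+ 2 * n%:R <= s%:R * (1 / p * z).
    apply: cE; rewrite /chromatic_bound.
    by rewrite ler_wpM2r ?(ltW z0) // ler_wpM2l ?divr_ge0 ?(ltW C20) // ge_min lexx.
  rewrite mulrA; apply: le_trans (ler_wpM2r (ltW p0) h) _.
  rewrite le_eqVlt; apply/orP; left; apply/eqP; field.
  by rewrite lt0r_neq0.
have E2 : C ^+ 2 * w <= s%:R * p `^ (k%:R / 2) * z.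
  have h : C ^+ 2 * n%:R <= s%:R * (p `^ (k%:R / 2) * n%:R / w * z).
    apply: cE; rewrite /chromatic_bound jE -/w.
    by rewrite ler_wpM2r ?(ltW z0) // ler_wpM2l ?divr_ge0 ?(ltW C20) // ge_min lexx orbT.
  have wn : 0 < w / n%:R by rewrite divr_gt0.
  have := ler_wpM2r (ltW wn) h; rewrite (_ : _ * n%:R * (w / n%:R) = C ^+ 2 * w); last first.
    by field; rewrite lt0r_neq0.
  move=> /le_trans; apply; rewrite le_eqVlt; apply/orP; left; apply/eqP; field.
  by rewrite !lt0r_neq0.
have sz : s%:R * z <= s%:R by rewrite ler_piMr.
have j1 : j = j.-1.+1 by rewrite prednK.
have spz : C ^+ 2 / 8 * (k%:R ^+ 5 * L) <= s%:R * p * (1 - p ^+ k) ^+ n.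
  have k5L : 0 <= k%:R ^+ 5 * L by rewrite mulr_ge0 ?exprn_ge0 // ltW.
  have zp : 0 <= z ^+ j.-1 by rewrite exprn_ge0 // ltW.
  rewrite -zj {1}j1 [z ^+ _]exprS [s%:R * p * _]mulrA [s%:R * p * z]mulrAC.
  have [jj|j2] := leqP j 1.
    have j_1 : j = 1%N by apply/eqP; rewrite eqn_leq jj.
    move: E2 k5L; rewrite /w /k j_1 expr0 mulr1 divr1 powRr1; last first.
      by move: fkL; rewrite /k j_1; apply: le_trans.
    rewrite divff ?powRr1 ?(ltW p0) // (_ : 2`! = 2%N) //.
    by rewrite [s%:R * p * z]mulrAC; move: (s%:R * z * p) => u; lra.
  have k3 : (3 <= k)%N by [].
  have zE : (1 - p ^+ k) `^ (n%:R * (k%:R - 2) / (k%:R - 1)) = z ^+ j.-1.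
    rewrite -[RHS]powR_mulrn ?powR_ge0 // -powRrM; congr (_ `^ _).
    have -> : k%:R - 2 = j.-1%:R :> R by rewrite /k {1}j1 -!natr1; ring.
    by rewrite mulrAC.
  move: edge_le; rewrite k3 mul1r zE => h.
  have h' := ler_wpM2l (ltW C20) h.
  apply: (@le_trans _ _ (C ^+ 2 * (k%:R ^+ 5 * L))).
    by apply: ler_wpM2r => //; have := C20; lra.
  apply: le_trans h' _; rewrite mulrA ler_wpM2r //.
  have [_|_] := leP (n%:R * p ^+ 2) (p `^ (- ((k%:R - 2) / 2))).
    have -> : p `^ (- ((k%:R - 2) / 2)) = p / p `^ (k%:R / 2).
      rewrite -{2}(powRr1 (ltW p0)) -powRB; last by rewrite (lt0r_neq0 p0) implybT.
      by congr (_ `^ _); field.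
    rewrite mulrA ler_pdivrMr // [leRHS]mulrAC ler_wpM2r ?(ltW p0) // [leRHS]mulrAC.
    by apply: le_trans E2; rewrite ler_peMr ?(ltW C20).
  by rewrite expr2 mulrA mulrA ler_wpM2r ?(ltW p0) // -mulrA.
split.
- exact: j0.
- exact: p0.
- by move: p_small; rewrite CE; lra.
- exact: np1.
- by rewrite -LE.
- exact: sn.
- move: fluct; rewrite -LE -/k CE; have -> : 6 * 1000 = 6000 :> R by lra.
  by rewrite !mulrA.
- by move: spz; rewrite -LE -/k CE; lra.
- rewrite -LE -/k -zj -CE.
  have Cw0 : 0 <= C ^+ 2 * w by rewrite mulr_ge0 // ltW.
  have R0 : 0 <= s%:R * p `^ (k%:R / 2) * z by apply: le_trans E2.
  have := lerXn2r j Cw0 R0 E2; rewrite exprMn wj => /le_trans; apply.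
  rewrite exprMn [(_ * p `^ _) ^+ j]exprMn le_eqVlt; apply/orP; left; apply/eqP.
  congr (_ * _ * _).
  rewrite -[LHS]powR_mulrn ?powR_ge0 // -powRrM -[RHS]powR_mulrn ?(ltW p0) //.
  congr (_ `^ _).
  have -> : 'C(k, 2)%:R = (k * j)%:R / 2 :> R.
    apply: (mulIf (x := 2)) => //; rewrite divfK // -natrM; congr (_%:R).
    by rewrite mulnC -mul_bin_diag bin1.
  by rewrite natrM; field.
- by rewrite -CE; apply: le_trans E1 sz.
Qed.

End Hypotheses.

Lemma gnp_prob_compl (R : realType) (n : nat) (p : R) (A : pred (sgraph 'I_n)) :
  gnp_prob p A = 1 - gnp_prob p (fun G => ~~ A G).
Proof. by rewrite -(gnp_prob_predT n p) /gnp_prob [X in X - _](bigID A) /= addrK. Qed.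

Lemma chromatic_lower_bound (R : realType) (C : R) (n j : nat) (p : R) :
  C = 1000 -> (0 < j)%N -> 0 <= p <= 1 -> 1 <= n%:R * p -> ln (1 / p) <= n%:R * p ->
  p <= (6 * C)^-1
   * (j.+1%:R ^+ 2 * ln (1 / p) * (n%:R * p)) `^ (- (1 / (2 * (j.+1%:R - 1))))
   * (1 - p ^+ j.+1) `^ (n%:R / (j.+1%:R - 1)) ->
  (3 <= j.+1)%N%:R * j.+1%:R ^+ 5 * ln (1 / p)
   <= Num.max (n%:R * p ^+ 2) (p `^ (- ((j.+1%:R - 2) / 2)))
      * (1 - p ^+ j.+1) `^ (n%:R * (j.+1%:R - 2) / (j.+1%:R - 1)) ->
  1 - (n%:R + 2) * expR (- (4 * (n%:R * p)))
  <= gnp_prob p (fun G : sgraph 'I_n =>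
       chromatic_bound C n j p <= (clique_chromatic G)%:R).
Proof.
move=> CE j0 p01 np1 Lnp p_le edge_le.
have B0 := chromatic_bound_gt0 CE j0 p01 np1 p_le.
set B := chromatic_bound C n j p in B0 *.
have p0 : 0 <= p by case/andP: p01.
have n0 : 0 < n%:R :> R.
  by rewrite lt_neqAle ler0n andbT; apply: contraTneq np1 => <-; rewrite mul0r ler10.
pose s := (Num.truncn (n%:R / B)).+1.
have nB0 : 0 <= n%:R / B by rewrite divr_ge0 // ltW.
have sB : n%:R <= s%:R * B.
  by rewrite -ler_pdivrMr //; apply: ltW; apply: truncnS_gt.
rewrite gnp_prob_compl lerD2l lerN2.
pose b (E : {set {set 'I_n}}) := [exists W : {set 'I_n}, (#|W| == s) && all_covered j W E].
apply: (@le_trans _ _ (Ex (edge_weight p) (fun E => (b E)%:R))).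
  apply: gnp_prob_le_Ex => // G; rewrite -ltNge => qB.
  move: qB; rewrite /clique_chromatic; case: ex_minnP => q /existsP[f fG] _ qB.
  have [|W cW fW] := @large_colour_class 'I_n q s f.
    rewrite card_ord -(ltr_nat R) natrM /=.
    apply: (@le_lt_trans _ _ (q%:R * (n%:R / B))).
      by rewrite ler_wpM2l // truncn_le.
    by rewrite mulrA ltr_pdivrMr // mulrC ltr_pM2l.
  by apply/existsP; exists W; rewrite cW eqxx (colour_class_covered j0 fG fW).
have [sn|ns] := leqP s n; last first.
  apply: (@le_trans _ _ 0); last by rewrite mulr_ge0 ?expR_ge0 ?addr_ge0.
  apply: Ex_le_cst => [|E]; first exact: edge_weight01.
  rewrite /b; case: existsP => // -[W /andP[/eqP cW _]].
  by move: (max_card W); rewrite cW card_ord leqNgt ns.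
have reg : regime #|'I_n| j s p.
  by rewrite card_ord; apply: (regime_of_hypotheses CE j0 p01 np1 Lnp p_le edge_le sn).
by have := covered_set_rare reg; rewrite card_ord.
Qed.

Lemma ln_le_powR (R : realType) (tau x : R) : 0 < tau -> 0 < x ->
  (2 / tau) `^ (2 / tau) <= x -> ln x <= x `^ tau.
Proof.
move=> t0 x0 xbig; pose y := x `^ (tau / 2).
have y0 : 0 < y by rewrite powR_gt0.
have t2 : 0 <= 2 / tau by rewrite divr_ge0 // ltW.
have ybig : 2 / tau <= y.
  have e : 2 / tau = ((2 / tau) `^ (2 / tau)) `^ (tau / 2).
    by rewrite -powRrM (_ : 2 / tau * (tau / 2) = 1) ?powRr1 //; field; rewrite lt0r_neq0.
  rewrite [leLHS]e ge0_ler_powR ?nnegrE ?powR_ge0 ?divr_ge0 ?(ltW t0) ?(ltW x0) //.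
have lnxE : ln x = 2 / tau * ln y.
  by rewrite ln_powR; field; rewrite lt0r_neq0.
have xE : x `^ tau = y * y.
  by rewrite -powRD ?(lt0r_neq0 x0) ?implybT // -mulrDr (_ : 2^-1 + 2^-1 = 1) ?mulr1 //; field.
rewrite lnxE xE; apply: (@le_trans _ _ (2 / tau * y)).
  by rewrite ler_wpM2l // ltW // ln_sublinear.
by rewrite ler_wpM2r // ltW.
Qed.

Local Open Scope classical_set_scope.

Theorem theorem3 (R : realType) :
  exists C : R, expR 1 <= C /\
    forall tau : R, 0 < tau -> tau < 1 ->
    forall (k : nat -> nat) (p : nat -> R),
    (\forall n \near \oo,
      [/\ (2 <= k n)%N,
          0 <= p n <= 1,
          n%:R `^ (- 1 + tau) <= p n,
          p n <= (6 * C)^-1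
                 * ((k n)%:R ^+ 2 * ln (1 / p n) * (n%:R * p n))
                     `^ (- (1 / (2 * ((k n)%:R - 1))))
                 * (1 - p n ^+ k n) `^ (n%:R / ((k n)%:R - 1))
        & (3 <= k n)%N%:R * (k n)%:R ^+ 5 * ln (1 / p n)
          <= Num.max (n%:R * p n ^+ 2) (p n `^ (- (((k n)%:R - 2) / 2)))
             * (1 - p n ^+ k n)
                 `^ (n%:R * ((k n)%:R - 2) / ((k n)%:R - 1))]) ->
    gnp_prob (p n)
      (fun G : sgraph 'I_n =>
         1 / C ^+ 2
         * Num.min (1 / p n)
             (p n `^ ((k n)%:R / 2) * n%:R
              / ((k n)`!%:R * (k n)%:R * ln (1 / p n))
                  `^ (1 / ((k n)%:R - 1)))
         * (1 - p n ^+ k n) `^ (n%:R / ((k n)%:R - 1))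
         <= (clique_chromatic G)%:R) @[n --> \oo] --> (1 : R).
Proof.
exists 1000; split.
  by apply: le_trans (expR1_le4 R) _; rewrite ler_nat.
have := erefl (1000 : R); move: {-2}(1000 : R) => C CE tau t0 t1 k p hyp.
apply/cvgrPdist_le => e e0.
near=> n.
have [k2 p01 ptau p_le edge_le] : [/\ (2 <= k n)%N, 0 <= p n <= 1,
          n%:R `^ (- 1 + tau) <= p n,
          p n <= (6 * C)^-1
                 * ((k n)%:R ^+ 2 * ln (1 / p n) * (n%:R * p n))
                     `^ (- (1 / (2 * ((k n)%:R - 1))))
                 * (1 - p n ^+ k n) `^ (n%:R / ((k n)%:R - 1))
        & (3 <= k n)%N%:R * (k n)%:R ^+ 5 * ln (1 / p n)
          <= Num.max (n%:R * p n ^+ 2) (p n `^ (- (((k n)%:R - 2) / 2)))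
             * (1 - p n ^+ k n)
                 `^ (n%:R * ((k n)%:R - 2) / ((k n)%:R - 1))] by near: n.
have n1 : 1 <= n%:R :> R by near: n; apply: nbhs_infty_ger.
have n_tau : (2 / tau) `^ (2 / tau) <= n%:R by near: n; apply: nbhs_infty_ger.
have n_e : 3 / e <= n%:R by near: n; apply: nbhs_infty_ger.
have n0 : 0 < n%:R :> R by apply: lt_le_trans n1.
have ln_tau := ln_le_powR t0 n0 n_tau.
have np_tau : n%:R `^ tau <= n%:R * p n.
  have := ler_wpM2l (ltW n0) ptau; apply: le_trans.
  rewrite -{2}(powRr1 (ltW n0)) -powRD ?(lt0r_neq0 n0) ?implybT //.
  by rewrite addrA subrr add0r.
have np1 : 1 <= n%:R * p n.
  by apply: le_trans np_tau; rewrite -[leLHS](powRr0 n%:R) ler_powR // ltW.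
have p0 : 0 < p n.
  by rewrite -(pmulr_rgt0 _ n0); apply: lt_le_trans np1.
have Lnp : ln (1 / p n) <= n%:R * p n.
  apply: le_trans (le_trans _ ln_tau) np_tau.
  rewrite ler_ln ?posrE ?divr_gt0 // ler_pdivrMr //.
have ntail : (n%:R + 2) * expR (- (4 * (n%:R * p n))) <= 3 / n%:R.
  have h : expR (- (4 * (n%:R * p n))) <= n%:R^-1 * n%:R^-1.
    apply: (@le_trans _ _ (expR (- ln n%:R + - ln n%:R))).
      rewrite ler_expR; have := le_trans ln_tau np_tau; have := np1; lra.
    by rewrite expRD expRN lnK ?posrE.
  have n2 : 0 <= n%:R + 2 :> R by lra.
  apply: le_trans (ler_wpM2l n2 h) _.
  rewrite mulrA ler_wpM2r ?invr_ge0 ?(ltW n0) // ler_pdivrMr //; lra.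
have := chromatic_lower_bound CE _ p01 np1 Lnp.
move: p_le edge_le; case: (k n) k2 => [//|[//|j]] _ p_le edge_le /(_ j.+1 isT p_le edge_le).
rewrite /chromatic_bound.
set P := gnp_prob _ _ => low.
have P1 : P <= 1.
  rewrite /P gnp_prob_compl lerBlDr lerDl; apply: sumr_ge0 => G _.
  apply: prodr_ge0 => ed _; have /andP[q0 q1] := p01.
  by case: ifP; rewrite ?subr_ge0.
rewrite ger0_norm ?subr_ge0 //.
have : 3 / n%:R <= e by rewrite ler_pdivrMr // mulrC -ler_pdivrMr.
move: ntail low; move: (expR _) => x; lra.
Unshelve. all: end_near.
Qed.
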